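(* Let $\mathcal T$ be a triangulation of a surface $S$ of topological type $(g,n)$ and let $\Theta:E\to[0,\pi)$ satisfy condition $\mathbf{(C1)}$. In Euclidean background geometry, the curvature map $Th:\mathbb R_+^{|V|}\to\mathbb R^{|V|}$ is injective up to scalings (i.e. $Th(r)=Th(r')$ implies $r'=cr$ for some $c>0$), and its image consists exactly of the vectors $(K_1,\dots,K_{|V|})$ satisfying $K_i<2\pi$ for $v_i\in V\setminus V_\partial$ and $K_i<\pi$ for $v_i\in V_\partial$, and, for every non-empty subset $A\subseteq V$, $$\sum_{v_i\in A}K_i\ge-\sum_{(e,v)\in Lk(A)}(\pi-\Theta(e))+2\pi\chi(G(A)\setminus\partial S)+\pi\chi(G(A)\cap\partial S),$$ with equality if and only if $A=V$.
   Context: $S$ is a compact oriented surface of genus $g$ whose boundary consists of $n\ge0$ disjoint simple closed curves. $\mathcal T$ has vertex set $V=\{v_1,\dots,v_{|V|}\}$, edge set $E$, triangle set $F$; $V_\partial$ is the set of boundary vertices. Condition $\mathbf{(C1)}$: whenever edges $e_1,e_2,e_3$ bound a triangle, $I(e_1)+I(e_2)I(e_3)\ge0$, $I(e_2)+I(e_3)I(e_1)\ge0$, $I(e_3)+I(e_1)I(e_2)\ge0$ with $I(e)=\cos\Theta(e)$. Curvature map (Euclidean): for $r\in\mathbb R_+^{|V|}$, each triangle $v_iv_jv_k$ is realized as the Euclidean triangle with side lengths $l_{ij}=\sqrt{r_i^2+r_j^2+2r_ir_j\cos\Theta([v_i,v_j])}$ and similarly $l_{jk},l_{ki}$ (valid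 triangles under $\mathbf{(C1)}$); gluing gives a Euclidean cone metric on $S$. $\sigma(v_i)$ is the sum of inner angles at $v_i$ of incident triangles; $K_i=2\pi-\sigma(v_i)$ for interior vertices, $K_i=\pi-\sigma(v_i)$ for boundary vertices; $Th(r)=(K_1,\dots,K_{|V|})$. For non-empty $A\subseteq V$: $G(A)$ is the union of the open cells of $\mathcal T$ having at least one vertex in $A$; for a union $X$ of open cells, $\chi(X)$ = #0-cells − #1-cells + #2-cells in $X$. $Lk(A)$ is the set of pairs $(e,v)$ with $v\in A$, $e\in E$ having no endpoint in $A$, and $e,v$ forming a triangle of $\mathcal T$. *)

(* Defs.v *)
From HB Require Import structures.
From mathcomp Require Import all_boot all_order all_algebra.
From mathcomp Require Import all_classical all_reals all_analysis.
Set Implicit Arguments. Unset Strict Implicit. Unset Printing Implicit Defensive.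
Import Order.TTheory GRing.Theory Num.Theory.
Local Open Scope ring_scope.

(* A triangulation is encoded as a (finite, abstract) simplicial complex on the
   vertex type V: [tri] is the set of triangles (3-element vertex sets); edges
   are the 2-element subsets of triangles. *)
Section Triangulation.
Variables (V : finType) (tri : {set {set V}}).

Definition edges : {set {set V}} :=
  [set e : {set V} | (#|e| == 2)%N && [exists t in tri, e \subset t]].

Definition ntri (e : {set V}) : nat := #|[set t in tri | e \subset t]|.

Definition bd_edge (e : {set V}) : bool := (e \in edges) && (ntri e == 1)%N.
Definition bd_vertex (v : V) : bool := [exists e in edges, bd_edge e && (v \in e)].

Definition adj (a b : V) : bool :=
  (a != b) && [exists t in tri, (a \in t) && (b \in t)].

Definition link_rel (v : V) (x y : V) : bool :=
  [&& adj v x, adj v y & [set v; x; y] \in tri].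

Definition is_surface_triangulation : Prop :=
  [/\ tri != finset.set0,
      (forall t, t \in tri -> #|t| = 3%N),
      (forall v : V, exists2 t, t \in tri & v \in t)
    & (forall e, e \in edges -> ntri e = 1%N \/ ntri e = 2%N)] /\
  [/\
      (* vertex links are connected (hence a path or a cycle) *)
      (forall v x y, adj v x -> adj v y -> connect (link_rel v) x y),
      (forall a b : V, connect adj a b)
    & (* orientability: each triangle carries a cyclic order [succ t]
         and adjacent triangles induce opposite orders on common edges *)
      exists succ : {set V} -> V -> V,
        (forall t, t \in tri -> forall a, a \in t -> succ t a \in t /\ succ t a != a)
        /\ (forall t, t \in tri -> {in t &, injective (succ t)})
        /\ (forall t t' a, t \in tri -> t' \in tri -> t != t' ->
              a \in t -> a \in t' -> succ t a \in t' -> succ t' a != succ t a)].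

Variable R : realType.
Variable Theta : {set V} -> R.

Definition elen (r : V -> R) (a b : V) : R :=
  Num.sqrt (r a ^+ 2 + r b ^+ 2 + 2 * r a * r b * cos (Theta [set a; b])).

(* inner angle at the vertex v of the Euclidean triangle t (law of cosines);
   u, w are the two other vertices of t (formula symmetric in u, w) *)
Definition tri_angle (r : V -> R) (t : {set V}) (v : V) : R :=
  let s := enum (t :\ v) in
  let u := nth v s 0 in
  let w := nth v s 1 in
  acos ((elen r v u ^+ 2 + elen r v w ^+ 2 - elen r u w ^+ 2)
        / (2 * elen r v u * elen r v w)).

Definition cone_angle (r : V -> R) (v : V) : R :=
  \sum_(t in tri | v \in t) tri_angle r t v.

Definition Th (r : V -> R) (v : V) : R :=
  (if bd_vertex v then pi else 2 * pi) - cone_angle r v.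

Definition C1 : Prop :=
  forall t, t \in tri -> forall a b c : V, t = [set a; b; c] -> a != b -> b != c -> a != c ->
    let I1 := cos (Theta [set b; c]) in
    let I2 := cos (Theta [set c; a]) in
    let I3 := cos (Theta [set a; b]) in
    [/\ 0 <= I1 + I2 * I3, 0 <= I2 + I3 * I1 & 0 <= I3 + I1 * I2].

Definition link_sum (A : {set V}) : R :=
  \sum_(e in edges) \sum_(v in A | [disjoint e & A] && (v |: e \in tri)) (pi - Theta e).

(* chi(G(A) \ dS): open cells meeting A that are not in the boundary *)
Definition chi_int (A : {set V}) : int :=
  (#|[set v in A | ~~ bd_vertex v]|%:Z
   - #|[set e in edges | ~~ bd_edge e & ~~ [disjoint e & A]]|%:Z
   + #|[set t in tri | ~~ [disjoint t & A]]|%:Z)%R.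

Definition chi_bd (A : {set V}) : int :=
  (#|[set v in A | bd_vertex v]|%:Z
   - #|[set e in edges | bd_edge e & ~~ [disjoint e & A]]|%:Z)%R.

End Triangulation.

(* Main.v *)
(* A boundary or interior cone angle differs from the curvature by a constant, and combining that
   constant over [A] with the Euler characteristics turns the inequality for [A] into
   a bound of the cone angles over [A] by the capacity of [A], to which a triangle with at least
   two vertices in [A] contributes pi and one with the single vertex v in [A], opposite e,
   contributes [pi - Theta e].

   The angle at a vertex of a triangle increases in the other two radii, strictly except along
   degenerate edges ([Theta = 0] and the two other angles supplementary); every vertex set is
   crossed by a nondegenerate edge. Hence a maximum principle at the maxima of r'/r, which gives
   injectivity. For surjectivity onto the polytope, take the least m in [0, 1] such that some r has
   cone angles at most [s + m (cone 1 - s + d)]: when radii collapse along a set A, the angle sum over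
   A tends to the capacity of A, which the constraints forbid, so the minimum is attained; if m > 0,
   enlarging the radii at the vertices with equality destroys equalities one after the other, and
   then m can be lowered. At m = 0 the angles are at most s and have the same total, so they equal s. *)
Require Import Defs.
From HB Require Import structures.
From mathcomp Require Import all_boot all_order all_algebra.
From mathcomp Require Import all_classical all_reals all_analysis.
From mathcomp Require Import ring lra.
Import Order.TTheory GRing.Theory Num.Theory.
Import numFieldNormedType.Exports.
Local Open Scope ring_scope.

(** * Angles of a single triangle with prescribed radii *)

Section OneTriangle.
Context {R : realType}.
Implicit Types p q r x y z : R.

Definition len2 x y r := x ^+ 2 + y ^+ 2 + 2 * x * y * r.

(** The law of cosines at the vertex of radius [x], with the factor 2 cancelled. Here [p], [q], [r]
    are the cosines of [Theta] on the edges opposite the vertices of radii [x], [y], [z], and [len2]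
    is a squared side length. *)
Definition ang_cos p q r x y z :=
  (x ^+ 2 + x * y * r + x * z * q - y * z * p)
  / (Num.sqrt (len2 x y r) * Num.sqrt (len2 x z q)).

Definition ang p q r x y z := acos (ang_cos p q r x y z).

(** Condition (C1) for one triangle in terms of cosines; excluding -1 reflects [Theta < pi]. *)
Definition admissible p q r :=
  [/\ -1 < p <= 1, -1 < q <= 1 & -1 < r <= 1] /\
  [/\ 0 <= p + q * r, 0 <= q + r * p & 0 <= r + p * q].

Lemma admissibleC p q r : admissible p q r -> admissible p r q.
Proof.
move=> [[hp hq hr] [h1 h2 h3]]; split; split => //; lra.
Qed.

Lemma admissible_rot p q r : admissible p q r -> admissible q r p.
Proof.
move=> [[hp hq hr] [h1 h2 h3]]; split; split => //; lra.
Qed.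

Lemma len2C x y r : len2 x y r = len2 y x r.
Proof. by rewrite /len2; ring. Qed.

Lemma angC p q r x y z : ang p q r x y z = ang p r q x z y.
Proof. by rewrite /ang /ang_cos [X in _ / X]mulrC; congr (acos (_ / _)); ring. Qed.

Lemma len2_gt0 x y r : -1 < r -> 0 <= x -> 0 <= y -> 0 < x + y -> 0 < len2 x y r.
Proof.
move=> hr hx hy hxy; rewrite /len2.
have [yE|y0] := leP y 0.
  have x0 : 0 < x by lra.
  have -> : y = 0 by lra.
  by rewrite expr0n mulr0 mul0r !addr0 exprn_gt0.
have [x0|x0] := leP x 0.
  have -> : x = 0 by lra.
  by rewrite expr0n mulr0 !mul0r addr0 add0r exprn_gt0.
have : 0 < 2 * x * y * (r + 1) by rewrite !mulr_gt0 //; lra.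
have : 0 <= (x - y) ^+ 2 by exact: sqr_ge0.
by move=> *; lra.
Qed.

Lemma len2_ge0 x y r : -1 < r -> 0 <= x -> 0 <= y -> 0 <= len2 x y r.
Proof.
move=> hr hx hy; have [h|h] := ltP 0 (x + y); first exact/ltW/len2_gt0.
have [-> ->] : x = 0 /\ y = 0 by lra.
by rewrite /len2; lra.
Qed.

(* Four times the squared area of the triangle, in a form where every term is nonnegative. *)
Definition area2 p q r x y z :=
  x ^+ 2 * y ^+ 2 * (1 - r ^+ 2) + x ^+ 2 * z ^+ 2 * (1 - q ^+ 2)
  + y ^+ 2 * z ^+ 2 * (1 - p ^+ 2)
  + 2 * x ^+ 2 * y * z * (p + q * r) + 2 * x * y ^+ 2 * z * (q + r * p)
  + 2 * x * y * z ^+ 2 * (r + p * q).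

Lemma area2E p q r x y z :
  len2 x y r * len2 x z q - (x ^+ 2 + x * y * r + x * z * q - y * z * p) ^+ 2
  = area2 p q r x y z.
Proof. by rewrite /len2 /area2; ring. Qed.

Lemma one_sqr_ge0 p : -1 < p <= 1 -> 0 <= 1 - p ^+ 2.
Proof. move=> /andP[h1 h2]; have -> : 1 - p ^+ 2 = (1 - p) * (1 + p) by ring.
by rewrite mulr_ge0 //; lra. Qed.

Lemma one_sqr_gt0 p : -1 < p < 1 -> 0 < 1 - p ^+ 2.
Proof. move=> /andP[h1 h2]; have -> : 1 - p ^+ 2 = (1 - p) * (1 + p) by ring.
by rewrite mulr_gt0 //; lra. Qed.

Lemma area2_ge0 p q r x y z : admissible p q r ->
  0 <= x -> 0 <= y -> 0 <= z -> 0 <= area2 p q r x y z.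
Proof.
move=> [[hp hq hr] [h1 h2 h3]] X Y Z.
have P := one_sqr_ge0 _ hp; have Q := one_sqr_ge0 _ hq; have S := one_sqr_ge0 _ hr.
have e1 : 0 <= x ^+ 2 * y ^+ 2 * (1 - r ^+ 2) by rewrite !(mulr_ge0, sqr_ge0).
have e2 : 0 <= x ^+ 2 * z ^+ 2 * (1 - q ^+ 2) by rewrite !(mulr_ge0, sqr_ge0).
have e3 : 0 <= y ^+ 2 * z ^+ 2 * (1 - p ^+ 2) by rewrite !(mulr_ge0, sqr_ge0).
have e4 : 0 <= 2 * x ^+ 2 * y * z * (p + q * r) by rewrite !(mulr_ge0, sqr_ge0).
have e5 : 0 <= 2 * x * y ^+ 2 * z * (q + r * p) by rewrite !(mulr_ge0, sqr_ge0).
have e6 : 0 <= 2 * x * y * z ^+ 2 * (r + p * q) by rewrite !(mulr_ge0, sqr_ge0).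
by rewrite /area2; lra.
Qed.

(** Some term is positive: the first if [r < 1], the second if [q < 1], and for [q = r = 1] the one
    containing [p + q * r = p + 1]. *)
Lemma area2_gt0 p q r x y z : admissible p q r ->
  0 < x -> 0 < y -> 0 < z -> 0 < area2 p q r x y z.
Proof.
move=> [[hp hq hr] [h1 h2 h3]] x0 y0 z0.
have X := ltW x0; have Y := ltW y0; have Z := ltW z0.
have P := one_sqr_ge0 _ hp; have Q := one_sqr_ge0 _ hq; have S := one_sqr_ge0 _ hr.
have e1 : 0 <= x ^+ 2 * y ^+ 2 * (1 - r ^+ 2) by rewrite !(mulr_ge0, sqr_ge0).
have e2 : 0 <= x ^+ 2 * z ^+ 2 * (1 - q ^+ 2) by rewrite !(mulr_ge0, sqr_ge0).
have e3 : 0 <= y ^+ 2 * z ^+ 2 * (1 - p ^+ 2) by rewrite !(mulr_ge0, sqr_ge0).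
have e4 : 0 <= 2 * x ^+ 2 * y * z * (p + q * r) by rewrite !(mulr_ge0, sqr_ge0).
have e5 : 0 <= 2 * x * y ^+ 2 * z * (q + r * p) by rewrite !(mulr_ge0, sqr_ge0).
have e6 : 0 <= 2 * x * y * z ^+ 2 * (r + p * q) by rewrite !(mulr_ge0, sqr_ge0).
rewrite /area2.
have [r1|r1] := ltP r 1.
  have : 0 < x ^+ 2 * y ^+ 2 * (1 - r ^+ 2).
    by rewrite !mulr_gt0 ?exprn_gt0 ?one_sqr_gt0 //; lra.
  by lra.
have [q1|q1] := ltP q 1.
  have : 0 < x ^+ 2 * z ^+ 2 * (1 - q ^+ 2).
    by rewrite !mulr_gt0 ?exprn_gt0 ?one_sqr_gt0 //; lra.
  by lra.
have er : r = 1 by lra.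
have eq : q = 1 by lra.
have : 0 < 2 * x ^+ 2 * y * z * (p + q * r).
  by rewrite er eq !mulr_gt0 ?exprn_gt0 //; lra.
by lra.
Qed.

Lemma ang_cos_sqr p q r x y z : 0 < len2 x y r -> 0 < len2 x z q ->
  1 - ang_cos p q r x y z ^+ 2 = area2 p q r x y z / (len2 x y r * len2 x z q).
Proof.
move=> h1 h2; rewrite -area2E /ang_cos expr_div_n exprMn !sqr_sqrtr ?ltW //.
by field; rewrite !gt_eqF.
Qed.

Lemma ang_cos_bound p q r x y z : admissible p q r ->
  0 <= x -> 0 <= y -> 0 <= z -> -1 <= ang_cos p q r x y z <= 1.
Proof.
move=> adm x0 y0 z0; have [[hp hq hr] _] := adm.
(* A side of length 0 makes the quotient 0, since the inverse of 0 is 0. *)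
have [l1|l1] := leP (len2 x y r) 0.
  by rewrite /ang_cos ler0_sqrtr // mul0r invr0 mulr0 lerN10 ler01.
have [l2|l2] := leP (len2 x z q) 0.
  by rewrite /ang_cos (ler0_sqrtr l2) // mulr0 invr0 mulr0 lerN10 ler01.
have := ang_cos_sqr p q r x y z l1 l2.
have : 0 <= area2 p q r x y z / (len2 x y r * len2 x z q).
  by rewrite divr_ge0 ?area2_ge0 // mulr_ge0 // ltW.
move: (ang_cos _ _ _ _ _ _) => c h e.
have {h e} : 0 <= 1 - c ^+ 2 by rewrite e.
by rewrite -ler_norml subr_ge0 -real_normK ?num_real // expr_le1.
Qed.

Lemma ang_cos_strict p q r x y z : admissible p q r ->
  0 < x -> 0 < y -> 0 < z -> -1 < ang_cos p q r x y z < 1.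
Proof.
move=> adm x0 y0 z0; have [[/andP[hp _] /andP[hq _] /andP[hr _]] _] := adm.
have l1 : 0 < len2 x y r by apply: len2_gt0 => //; lra.
have l2 : 0 < len2 x z q by apply: len2_gt0 => //; lra.
have := ang_cos_sqr p q r x y z l1 l2.
have : 0 < area2 p q r x y z / (len2 x y r * len2 x z q).
  by rewrite divr_gt0 ?area2_gt0 // mulr_gt0.
move=> + h; rewrite -h subr_gt0 -real_normK ?num_real // expr_lt1 //.
by rewrite ltr_norml.
Qed.

Lemma ang_gt0 p q r x y z : admissible p q r ->
  0 < x -> 0 < y -> 0 < z -> 0 < ang p q r x y z.
Proof.
move=> adm x0 y0 z0; have /andP[h1 h2] := ang_cos_strict p q r x y z adm x0 y0 z0.
by rewrite acos_gt0 // h2 ltW.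
Qed.

Lemma ang_ltpi p q r x y z : admissible p q r ->
  0 < x -> 0 < y -> 0 < z -> ang p q r x y z < pi.
Proof.
move=> adm x0 y0 z0; have /andP[h1 h2] := ang_cos_strict p q r x y z adm x0 y0 z0.
by rewrite acos_ltpi // h1 ltW.
Qed.

Lemma cos_ang p q r x y z : admissible p q r ->
  0 <= x -> 0 <= y -> 0 <= z -> cos (ang p q r x y z) = ang_cos p q r x y z.
Proof. by move=> adm *; rewrite acosK // in_itv /=; exact: ang_cos_bound. Qed.

Lemma sin_ang p q r x y z : admissible p q r ->
  0 < x -> 0 < y -> 0 < z ->
  sin (ang p q r x y z) =
  Num.sqrt (area2 p q r x y z) / (Num.sqrt (len2 x y r) * Num.sqrt (len2 x z q)).
Proof.
move=> adm x0 y0 z0; have [[/andP[hp _] /andP[hq _] /andP[hr _]] _] := adm.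
have l1 : 0 < len2 x y r by apply: len2_gt0 => //; lra.
have l2 : 0 < len2 x z q by apply: len2_gt0 => //; lra.
rewrite sin_acos; last by apply: ang_cos_bound => //; exact: ltW.
rewrite ang_cos_sqr // sqrtrM ?sqrtrV ?sqrtrM ?mulr_ge0 ?ltW //.
exact: area2_gt0.
Qed.

(** The sum of the first two angles has the sine of the third angle and minus its cosine, by direct
    computation; injectivity of cosine on [0, pi] concludes once this sum is known to be below
    pi. *)
Lemma ang_sum p q r x y z : admissible p q r ->
  0 < x -> 0 < y -> 0 < z ->
  ang p q r x y z + ang q r p y z x + ang r p q z x y = pi.
Proof.
move=> adm x0 y0 z0; have [[/andP[hp _] /andP[hq _] /andP[hr _]] _] := adm.
have X := ltW x0; have Y := ltW y0; have Z := ltW z0.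
have admq := admissible_rot _ _ _ adm; have admr := admissible_rot _ _ _ admq.
have l1 : 0 < len2 x y r by apply: len2_gt0 => //; lra.
have l2 : 0 < len2 x z q by apply: len2_gt0 => //; lra.
have l3 : 0 < len2 y z p by apply: len2_gt0 => //; lra.
have s1 : 0 < Num.sqrt (len2 x y r) by rewrite sqrtr_gt0.
have s2 : 0 < Num.sqrt (len2 x z q) by rewrite sqrtr_gt0.
have s3 : 0 < Num.sqrt (len2 y z p) by rewrite sqrtr_gt0.
have k1 := sqr_sqrtr (ltW l1); have k2 := sqr_sqrtr (ltW l2).
have k3 := sqr_sqrtr (ltW l3).
have aE : area2 q r p y z x = area2 p q r x y z by rewrite /area2; ring.
have aE' : area2 r p q z x y = area2 p q r x y z by rewrite /area2; ring.
have k4 := sqr_sqrtr (area2_ge0 _ _ _ _ _ _ adm X Y Z).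
have A := ang_gt0 _ _ _ _ _ _ adm x0 y0 z0; have A' := ang_ltpi _ _ _ _ _ _ adm x0 y0 z0.
have B := ang_gt0 _ _ _ _ _ _ admq y0 z0 x0; have B' := ang_ltpi _ _ _ _ _ _ admq y0 z0 x0.
have C := ang_gt0 _ _ _ _ _ _ admr z0 x0 y0; have C' := ang_ltpi _ _ _ _ _ _ admr z0 x0 y0.
have sC : 0 < sin (ang r p q z x y) by rewrite sin_gt0_pi // C.
have sAB : sin (ang p q r x y z + ang q r p y z x) = sin (ang r p q z x y).
  rewrite sinD !sin_ang // !cos_ang // aE aE' /ang_cos.
  rewrite (len2C y x) (len2C z x) (len2C z y).
  set a := Num.sqrt (len2 x y r); set b := Num.sqrt (len2 x z q).
  set c := Num.sqrt (len2 y z p); set d := Num.sqrt _.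
  have e : forall u v, d / (a * b) * (u / (c * a)) + v / (a * b) * (d / (c * a)) =
     d * (u + v) / (a ^+ 2 * b * c).
    by move=> u v; field; rewrite !gt_eqF.
  rewrite e k1.
  have -> : y ^+ 2 + y * z * p + y * x * r - z * x * q
     + (x ^+ 2 + x * y * r + x * z * q - y * z * p) = len2 x y r by rewrite /len2; ring.
  by field; rewrite !gt_eqF.
have cAB : cos (ang p q r x y z + ang q r p y z x) = - cos (ang r p q z x y).
  rewrite cosD !sin_ang // !cos_ang // aE /ang_cos.
  rewrite (len2C y x) (len2C z x) (len2C z y).
  set a := Num.sqrt (len2 x y r); set b := Num.sqrt (len2 x z q).
  set c := Num.sqrt (len2 y z p); set d := Num.sqrt _.
  have e : forall u v w : R, u / (a * b) * (v / (c * a)) - d / (a * b) * (d / (c * a)) =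
     (u * v - d ^+ 2) / (a ^+ 2 * b * c).
    by move=> u v w; field; rewrite !gt_eqF.
  rewrite e // k4 k1 -/a.
  by rewrite /area2 /len2; field; rewrite !gt_eqF.
(* Otherwise subtracting pi would leave an angle in [0, pi] with negative sine. *)
have lt : ang p q r x y z + ang q r p y z x < pi.
  rewrite ltNge; apply/negP => h.
  have : 0 <= sin (ang p q r x y z + ang q r p y z x - pi).
    by apply: sin_ge0_pi; lra.
  by rewrite sinB sinpi cospi mulr0 subr0 mulrN1; lra.
have : ang p q r x y z + ang q r p y z x = pi - ang r p q z x y.
  apply: cos_inj; rewrite ?in_itv /=; [lra|lra|].
  by rewrite cAB cosB cospi sinpi mul0r addr0 mulN1r.
by lra.
Qed.

End OneTriangle.

(** * Monotonicity of an angle in the radii at the other two vertices *)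

Section Monotone.
Context {R : realType}.
Implicit Types p q r x y z : R.

(* [(P + Q w) / sqrt (w^2 + k)] has derivative [(Q k - P w) / sqrt (w^2 + k)^3]; [b] bounds
   the negated numerator from below at both ends, and the quantity estimated is
   [(s1 + s2) / (w2 - w1)] times the decrease of the cross-multiplied quotients. *)
Lemma quotient_decr_core (P Q k b w1 w2 s1 s2 : R) :
  0 <= k -> 0 <= b -> w1 < w2 -> 0 < s1 -> 0 < s2 ->
  s1 ^+ 2 = w1 ^+ 2 + k -> s2 ^+ 2 = w2 ^+ 2 + k ->
  0 <= P -> 0 < w1 \/ 0 < k ->
  Q * k + b <= P * w1 -> Q * k + b <= P * w2 ->
  2 * b <= P * (w1 + w2) + Q * (w1 * w2 - k - s1 * s2).
Proof.
move=> k0 b0 w12 s1_gt0 s2_gt0 e1 e2 P0 wk h1 h2.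
have [Q0|Q0] := leP Q 0.
  (* Cauchy-Schwarz for the plane vectors with first coordinates [w1], [w2] and second coordinate
     the root of [k]; their norms are [s1] and [s2]. *)
  have h : w1 * w2 + k <= s1 * s2.
    have [/ltW neg|pos] := ltP (w1 * w2 + k) 0.
      by rewrite (le_trans neg) // mulr_ge0 // ltW.
    rewrite -(@ler_pXn2r _ 2) ?nnegrE ?mulr_ge0 ?(ltW s1_gt0) ?(ltW s2_gt0) //.
    rewrite exprMn e1 e2.
    have : 0 <= k * (w1 - w2) ^+ 2 by rewrite mulr_ge0 ?sqr_ge0.
    by move=> ?; lra.
  have : 0 <= (- Q) * (s1 * s2 - (w1 * w2 + k)) by rewrite mulr_ge0; lra.
  by move=> ?; lra.
have w1_gt0 : 0 < w1.
  case: wk => // kp; rewrite ltNge; apply/negP => w1n.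
  have : 0 < Q * k by rewrite mulr_gt0.
  have : 0 <= P * (- w1) by rewrite mulr_ge0 //; lra.
  by move=> ? ?; lra.
have w2_gt0 : 0 < w2 by lra.
(* For positive [w] the quotient of [w] by the root of [w ^+ 2 + k] is nondecreasing. *)
have h : w1 * s2 <= w2 * s1.
  rewrite -(@ler_pXn2r _ 2) ?nnegrE ?mulr_ge0 ?(ltW s1_gt0) ?(ltW s2_gt0)
    ?(ltW w1_gt0) ?(ltW w2_gt0) //.
  rewrite !exprMn e1 e2.
  have : 0 <= k * ((w2 - w1) * (w2 + w1)) by rewrite !mulr_ge0 //; lra.
  by move=> ?; lra.
(* Multiplied by [w1], the difference is the sum of the left-hand quantities of [a1], [a2] and [a3],
   up to the identity [a4]. *)
rewrite -subr_ge0 -(pmulr_rge0 _ w1_gt0).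
have a1 : 0 <= Q * s1 * (w2 * s1 - w1 * s2) by rewrite !mulr_ge0 ?(ltW Q0) ?(ltW s1_gt0) //; lra.
have a2 : 0 <= (P * w1 - Q * k - b) * (w1 + w2) by rewrite mulr_ge0 //; lra.
have a3 : 0 <= b * (w2 - w1) by rewrite mulr_ge0 //; lra.
have a4 : Q * w2 * (s1 ^+ 2) = Q * w2 * (w1 ^+ 2 + k) by rewrite e1.
by lra.
Qed.

(** The condition for the angle at the vertex of radius [x] to depend strictly on [y]. For
    admissible cosines its failure means [r = 1] and [q = - p]; the numerator of [ang_cos] is then
    [(x + y) * (x - z * p)], the factor [x + y] cancels, and the angle is independent of [y]. *)
Definition flexible p q r := (r < 1) || (0 < p + q).

Lemma ang_cos_decr_aux p q r x y1 y2 z : admissible p q r ->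
  0 < x -> 0 < y1 -> y1 < y2 -> 0 < z ->
  ang_cos p q r x y2 z <= ang_cos p q r x y1 z /\
  (flexible p q r -> ang_cos p q r x y2 z < ang_cos p q r x y1 z).
Proof.
move=> adm x0 y0 y12 z0; have [[hp hq hr] [c1 c2 c3]] := adm.
have y20 : 0 < y2 by lra.
have l1 : 0 < len2 x y1 r by apply: len2_gt0; lra.
have l2 : 0 < len2 x y2 r by apply: len2_gt0; lra.
have l3 : 0 < len2 x z q by apply: len2_gt0; lra.
have S := one_sqr_ge0 _ hr.
set s1 := Num.sqrt (len2 x y1 r); set s2 := Num.sqrt (len2 x y2 r).
have s1_gt0 : 0 < s1 by rewrite sqrtr_gt0.
have s2_gt0 : 0 < s2 by rewrite sqrtr_gt0.
have s3_gt0 : 0 < Num.sqrt (len2 x z q) by rewrite sqrtr_gt0.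
(* Completing the square with [w = y + x * r] turns [len2 x y r] into [w ^+ 2 + k] and the numerator
   of the cosine into [P + Q * w]. The bound [b] equals [P * w1 - Q * k], regrouped into terms that
   admissibility makes nonnegative. *)
pose k := x ^+ 2 * (1 - r ^+ 2).
pose w1 := y1 + x * r; pose w2 := y2 + x * r.
pose P := k + x * z * (q + r * p); pose Q := x * r - z * p.
pose b := x * (x * y1 * (1 - r ^+ 2) + z * (x * (p + q * r) + y1 * (q + r * p))).
have k0 : 0 <= k by rewrite mulr_ge0 ?sqr_ge0.
have a1 : 0 <= x * y1 * (1 - r ^+ 2) by rewrite !mulr_ge0 // ltW.
have a2 : 0 <= x * (p + q * r) by rewrite !mulr_ge0 // ltW.
have a3 : 0 <= y1 * (q + r * p) by rewrite !mulr_ge0 // ltW.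
have b0 : 0 <= b by apply: mulr_ge0; [lra|apply: addr_ge0 => //; apply: mulr_ge0; lra].
have e1 : s1 ^+ 2 = w1 ^+ 2 + k by rewrite sqr_sqrtr ?ltW // /len2 /w1 /k; ring.
have e2 : s2 ^+ 2 = w2 ^+ 2 + k by rewrite sqr_sqrtr ?ltW // /len2 /w2 /k; ring.
have P0 : 0 <= P by rewrite addr_ge0 // !mulr_ge0 // ltW.
have wk : 0 < w1 \/ 0 < k.
  have [r1|r1] := ltP r 1.
    by right; rewrite mulr_gt0 ?exprn_gt0 // one_sqr_gt0 //; lra.
  left; have -> : w1 = y1 + x * 1 by rewrite /w1; congr (_ + _ * _); lra.
  lra.
have h1 : Q * k + b <= P * w1.
  by rewrite le_eqVlt; apply/orP; left; apply/eqP; rewrite /Q /b /P /w1 /k; ring.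
have h2 : Q * k + b <= P * w2.
  have -> : P * w2 = Q * k + b + (y2 - y1) * P by rewrite /Q /b /P /w2 /k; ring.
  by rewrite lerDl mulr_ge0 //; lra.
have w12 : w1 < w2 by rewrite /w1 /w2; lra.
have core := quotient_decr_core P Q k b w1 w2 s1 s2 k0 b0 w12 s1_gt0 s2_gt0 e1 e2 P0 wk h1 h2.
set T := _ + _ in core.
have E : ang_cos p q r x y1 z - ang_cos p q r x y2 z =
   (y2 - y1) / (s1 * s2 * Num.sqrt (len2 x z q) * (s1 + s2)) * T.
  rewrite /ang_cos -/s1 -/s2.
  set s3 := Num.sqrt _.
  have N1 : x ^+ 2 + x * y1 * r + x * z * q - y1 * z * p = P + Q * w1 by rewrite /P /Q /w1 /k; ring.
  have N2 : x ^+ 2 + x * y2 * r + x * z * q - y2 * z * p = P + Q * w2 by rewrite /P /Q /w2 /k; ring.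
  rewrite N1 N2 /T; have -> : y2 - y1 = w2 - w1 by rewrite /w1 /w2; ring.
  have K : (P + Q * w1) * s2 - (P + Q * w2) * s1 = (w2 - w1) * (P * (w1 + w2) + Q * (w1 * w2 - k - s1 * s2)) / (s1 + s2).
    apply: (@mulIf _ (s1 + s2)); first by rewrite gt_eqF // addr_gt0.
    rewrite mulfVK ?gt_eqF ?addr_gt0 //.
    transitivity ((P + Q * w1) * (s1 * s2 + s2 ^+ 2) - (P + Q * w2) * (s1 ^+ 2 + s1 * s2)); first by ring.
    by rewrite e1 e2; ring.
  transitivity (((P + Q * w1) * s2 - (P + Q * w2) * s1) / (s1 * s2 * s3)).
    by field; rewrite !gt_eqF.
  rewrite K; field; by rewrite !gt_eqF ?addr_gt0.
have c0 : 0 < (y2 - y1) / (s1 * s2 * Num.sqrt (len2 x z q) * (s1 + s2)).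
  by rewrite divr_gt0 ?subr_gt0 // !mulr_gt0 // addr_gt0.
split.
  by rewrite -subr_ge0 E mulr_ge0 // ?(ltW c0) //; lra.
move=> fl; rewrite -subr_gt0 E mulr_gt0 //.
(* By [core], [T] is at least [2 * b]. *)
suff : 0 < b by lra.
rewrite mulr_gt0 //.
have a4 : 0 <= z * (x * (p + q * r)) by rewrite mulr_ge0 // ltW.
have a5 : 0 <= z * (y1 * (q + r * p)) by rewrite mulr_ge0 // ltW.
have [r1|r1] := ltP r 1.
  have : 0 < x * y1 * (1 - r ^+ 2) by rewrite !mulr_gt0 // one_sqr_gt0 //; lra.
  by lra.
have rE : r = 1 by lra.
have pq : 0 < p + q by move: fl; rewrite /flexible rE ltxx.
have : 0 < z * (x * (p + q * r)) by rewrite rE !mulr_gt0 //; lra.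
by lra.
Qed.

Lemma ang_scale p q r x y z c : 0 < c ->
  ang p q r (c * x) (c * y) (c * z) = ang p q r x y z.
Proof.
move=> c0; rewrite /ang /ang_cos; congr acos.
have E u v s : len2 (c * u) (c * v) s = c ^+ 2 * len2 u v s by rewrite /len2; ring.
rewrite !E !(sqrtrM _ (sqr_ge0 c)) sqrtr_sqr ger0_norm ?(ltW c0) //.
have [->|s1] := eqVneq (Num.sqrt (len2 x y r)) 0; first by rewrite !(mulr0, mul0r, invr0).
have [->|s2] := eqVneq (Num.sqrt (len2 x z q)) 0; first by rewrite !(mulr0, mul0r, invr0).
by field; rewrite s1 s2 (gt_eqF c0).
Qed.

Lemma ang_lt_of_cos p q r x y z p' q' r' x' y' z' :
  admissible p q r -> admissible p' q' r' ->
  0 <= x -> 0 <= y -> 0 <= z -> 0 <= x' -> 0 <= y' -> 0 <= z' ->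
  ang_cos p q r x y z < ang_cos p' q' r' x' y' z' -> ang p' q' r' x' y' z' < ang p q r x y z.
Proof.
move=> a a' *; rewrite -ltr_cos ?cos_ang // in_itv /= acos_ge0 ?acos_lepi //; exact: ang_cos_bound.
Qed.

Lemma ang_incr p q r x y1 y2 z : admissible p q r ->
  0 < x -> 0 < y1 -> y1 <= y2 -> 0 < z -> ang p q r x y1 z <= ang p q r x y2 z.
Proof.
move=> adm x0 y0; rewrite le_eqVlt => /orP[/eqP ->//|y12] z0.
have [h _] := ang_cos_decr_aux p q r x y1 y2 z adm x0 y0 y12 z0.
rewrite leNgt; apply/negP => h'; move: h; apply/negP; rewrite -ltNge.
have X := ltW x0; have Y := ltW y0; have Y2 := ltW (lt_trans y0 y12); have Z := ltW z0.
rewrite -(cos_ang _ _ _ _ _ _ adm X Y Z) -(cos_ang _ _ _ _ _ _ adm X Y2 Z).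
by rewrite ltr_cos // in_itv /= acos_ge0 ?acos_lepi //; exact: ang_cos_bound.
Qed.

Lemma ang_incr_strict p q r x y1 y2 z : admissible p q r -> flexible p q r ->
  0 < x -> 0 < y1 -> y1 < y2 -> 0 < z -> ang p q r x y1 z < ang p q r x y2 z.
Proof.
move=> adm fl x0 y0 y12 z0.
have [_ /(_ fl) h] := ang_cos_decr_aux p q r x y1 y2 z adm x0 y0 y12 z0.
by apply: ang_lt_of_cos => //; rewrite ltW // (lt_trans y0).
Qed.

(* The maximum principle: the angle drops at a vertex where the radius grows fastest. *)
Lemma ang_max p q r x y z x' y' z' : admissible p q r ->
  0 < x -> 0 < y -> 0 < z -> 0 < x' -> 0 < y' -> 0 < z' ->
  y' * x <= y * x' -> z' * x <= z * x' -> ang p q r x' y' z' <= ang p q r x y z.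
Proof.
move=> adm x0 y0 z0 x'0 y'0 z'0 hy hz.
(* Rescaling gives both triangles the radius [x] at the apex; the other two radii are then at most
   [y] and [z], and are changed one at a time. *)
rewrite -(ang_scale p q r x' y' z' (x / x')) ?divr_gt0 // divfK ?gt_eqF //.
have e u : x / x' * u = u * x / x' by rewrite mulrC mulrA.
rewrite !e; apply: (@le_trans _ _ (ang p q r x (y' * x / x') z)).
  rewrite angC [leRHS]angC; apply: ang_incr; rewrite ?divr_gt0 ?mulr_gt0 //.
    exact: admissibleC.
  by rewrite ler_pdivrMr.
by apply: ang_incr; rewrite ?divr_gt0 ?mulr_gt0 // ler_pdivrMr.
Qed.

Lemma ang_max_strict p q r x y z x' y' z' : admissible p q r -> flexible p q r ->
  0 < x -> 0 < y -> 0 < z -> 0 < x' -> 0 < y' -> 0 < z' ->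
  y' * x < y * x' -> z' * x <= z * x' -> ang p q r x' y' z' < ang p q r x y z.
Proof.
move=> adm fl x0 y0 z0 x'0 y'0 z'0 hy hz.
rewrite -(ang_scale p q r x' y' z' (x / x')) ?divr_gt0 // divfK ?gt_eqF //.
have e u : x / x' * u = u * x / x' by rewrite mulrC mulrA.
rewrite !e; apply: (@le_lt_trans _ _ (ang p q r x (y' * x / x') z)).
  rewrite angC [leRHS]angC; apply: ang_incr; rewrite ?divr_gt0 ?mulr_gt0 //.
    exact: admissibleC.
  by rewrite ler_pdivrMr.
by apply: ang_incr_strict; rewrite ?divr_gt0 ?mulr_gt0 // ltr_pdivrMr.
Qed.

End Monotone.

(** * Continuity of angles, including vanishing radii, and the limit angles *)

Section Limits.
Context {R : realType}.
Local Open Scope classical_set_scope.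
Implicit Types p q r x y z : R.

Lemma len2_cvg {T : Type} (F : set_system T) {FF : Filter F} r (X Y : T -> R) x y :
  X t @[t --> F] --> x -> Y t @[t --> F] --> y ->
  len2 (X t) (Y t) r @[t --> F] --> len2 x y r.
Proof.
move=> hX hY; rewrite /len2 !expr2.
apply: cvgD; first by apply: cvgD; apply: cvgM.
by apply: cvgM; [apply: cvgM => //; apply: cvgM => //; apply: cvg_cst|apply: cvg_cst].
Qed.

Lemma ang_cos_cvg {T : Type} (F : set_system T) {FF : Filter F} p q r
    (X Y Z : T -> R) x y z :
  X t @[t --> F] --> x -> Y t @[t --> F] --> y -> Z t @[t --> F] --> z ->
  0 < len2 x y r -> 0 < len2 x z q ->
  ang_cos p q r (X t) (Y t) (Z t) @[t --> F] --> ang_cos p q r x y z.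
Proof.
move=> hX hY hZ l1 l2; rewrite /ang_cos; apply: cvgM.
  rewrite expr2; apply: cvgB.
    apply: cvgD; last by apply: cvgM; [apply: cvgM|apply: cvg_cst].
    by apply: cvgD; [apply: cvgM|apply: cvgM; [apply: cvgM|apply: cvg_cst]].
  by apply: cvgM; [apply: cvgM|apply: cvg_cst].
apply: cvgV; first by rewrite mulf_neq0 // gt_eqF // sqrtr_gt0.
by apply: cvgM;
  apply: (@cvg_comp _ _ _ (fun t => len2 _ _ _) Num.sqrt F _ _ (len2_cvg F _ _ _ _ _ _ _));
  first [exact: sqrt_continuous | eassumption].
Qed.

(** Continuity of [acos] comes from inverting cosine on [0, pi], so it is available only within
    [-1, 1]; hence the condition on the values of [C]. *)
Lemma acos_cvg {T : Type} (F : set_system T) {FF : Filter F} (C : T -> R) (c : R) :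
  -1 <= c <= 1 -> (\forall t \near F, -1 <= C t <= 1) -> C t @[t --> F] --> c ->
  acos (C t) @[t --> F] --> acos c.
Proof.
move=> hc hC Cc.
have cont : {within `[cos pi, cos 0], continuous (@acos R)}.
  apply: segment_can_ge_continuous; first exact: pi_ge0.
    by apply: continuous_subspaceT; exact: continuous_cos.
  exact: cosK.
move/subspace_continuousP/(_ c) : cont; rewrite cospi cos0 /= in_itv /= => /(_ hc) h.
move=> B /h /=; rewrite /within /= => /Cc; rewrite /nbhs /=.
by apply: filterS2 hC => t h1 /=; apply; rewrite in_itv.
Qed.

(** The last condition keeps the two sides at the apex from collapsing in the limit; the opposite
    side may collapse. *)
Lemma ang_cvg {T : Type} (F : set_system T) {FF : Filter F} p q r
    (X Y Z : T -> R) x y z : admissible p q r ->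
  (forall t, 0 <= X t) -> (forall t, 0 <= Y t) -> (forall t, 0 <= Z t) ->
  0 <= x -> 0 <= y -> 0 <= z ->
  X t @[t --> F] --> x -> Y t @[t --> F] --> y -> Z t @[t --> F] --> z ->
  0 < x \/ 0 < y /\ 0 < z ->
  ang p q r (X t) (Y t) (Z t) @[t --> F] --> ang p q r x y z.
Proof.
move=> adm X0 Y0 Z0 x0 y0 z0 hX hY hZ pos.
have [[/andP[hp _] /andP[hq _] /andP[hr _]] _] := adm.
apply: acos_cvg; rewrite ?ang_cos_bound //; first by near=> t; exact: ang_cos_bound.
by apply: ang_cos_cvg => //; apply: len2_gt0 => //; case: pos; lra.
Unshelve. all: by end_near.
Qed.

Lemma ang_cos_apex0 p q r y z : 0 < y -> 0 < z -> ang_cos p q r 0 y z = - p.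
Proof.
move=> y0 z0; rewrite /ang_cos /len2 expr0n !(mulr0, mul0r, addr0, add0r).
rewrite !sqrtr_sqr !ger0_norm ?ltW //; field; by rewrite !gt_eqF.
Qed.

Lemma ang_opposite0 p q r x : 0 < x -> ang p q r x 0 0 = 0.
Proof.
move=> x0; rewrite /ang /ang_cos /len2 expr0n !(mulr0, mul0r, addr0, add0r).
by rewrite subr0 !sqrtr_sqr !ger0_norm ?ltW // -expr2 divff ?acos1 // gt_eqF // exprn_gt0.
Qed.

Lemma ang_apex0 (theta : R) q r y z : 0 <= theta < pi -> 0 < y -> 0 < z ->
  ang (cos theta) q r 0 y z = pi - theta.
Proof.
move=> th y0 z0; rewrite /ang ang_cos_apex0 //.
have -> : - cos theta = cos (pi - theta) by rewrite cosB cospi sinpi; ring.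
by rewrite cosK // in_itv /=; lra.
Qed.

Lemma flexible_or p q r : admissible p q r -> flexible p q r || flexible p r q.
Proof.
move=> [[hp hq hr] [h1 h2 h3]]; rewrite /flexible.
have [//|r1] := ltP r 1; have [|q1] := ltP q 1; first by rewrite !orbT.
by have -> : 0 < p + q by lra.
Qed.

(** The angle grows to [pi - theta] as the apex radius decreases to 0. Passing first from [x] to
    [x / 2] gains a strict inequality, which the limit alone would lose. *)
Lemma ang_lt_apex (theta : R) q r x y z : admissible (cos theta) q r ->
  0 <= theta < pi -> 0 < x -> 0 < y -> 0 < z ->
  ang (cos theta) q r x y z < pi - theta.
Proof.
move=> adm th x0 y0 z0.
set p := cos theta in adm *.
have x2 : 0 < x / 2 by lra.
apply: (@lt_le_trans _ _ (ang p q r (x / 2) y z)).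
  case/orP: (flexible_or _ _ _ adm) => fl.
    by apply: ang_max_strict => //; first rewrite ltr_pM2l //; rewrite ?ler_pM2l //; lra.
  rewrite angC [ltRHS]angC; apply: ang_max_strict => //.
  - exact: admissibleC.
  - by rewrite ltr_pM2l //; lra.
  - by rewrite ler_pM2l //; lra.
rewrite -(ang_apex0 theta q r y z) // -/p.
have cv : ang p q r t y z @[t --> 0^'+] --> ang p q r 0 y z.
  apply: acos_cvg; first by apply: ang_cos_bound => //; exact: ltW.
    near=> t.
    have t0 : 0 < t by near: t; exact: nbhs_right_gt.
    by apply: ang_cos_bound => //; exact: ltW.
  have [[/andP[hp _] /andP[hq _] /andP[hr _]] _] := adm.
  apply: ang_cos_cvg; try exact: cvg_cst.
  - exact: cvg_at_right_filter.
  - by apply: len2_gt0 => //; lra.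
  - by apply: len2_gt0 => //; lra.
apply: (ler_cvg_to (cvg_cst _) cv).
near=> t.
have t0 : 0 < t by near: t; exact: nbhs_right_gt.
have tx : t <= x / 2 by near: t; apply: nbhs_right_ltW.
by apply: ang_max => //; rewrite ler_pM2l //.
Unshelve. all: by end_near.
Qed.

End Limits.

(** * Finite sets: crossing edges and three-element sets *)

Lemma connect_crossing (T : finType) (e : rel T) (B : {set T}) x y :
  connect e x y -> x \in B -> y \notin B ->
  exists u v, [/\ e u v, u \in B & v \notin B].
Proof.
move=> /connectP[s + ->]; elim: s x => [|z s IH] x /=; first by move=> _ ->.
case/andP=> xz ps xB yB; have [zB|zB] := boolP (z \in B); first exact: IH ps zB yB.
by exists x, z.
Qed.

Lemma set3C (T : finType) (a b c : T) : [set a; b; c] = [set a; c; b] :> {set T}.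
Proof. by rewrite finset.setUAC. Qed.

Lemma set3_rot (T : finType) (a b c : T) : [set a; b; c] = [set b; c; a] :> {set T}.
Proof. by apply/finset.setP => x; rewrite !inE; case: (x == a); case: (x == b); case: (x == c). Qed.

Lemma set3D1 (T : finType) (a b c : T) : a != b -> c != a ->
  [set a; b; c] :\ a = [set b; c].
Proof.
move=> ab ca; apply/finset.setP => x; rewrite !inE; case: (eqVneq x a) => //= ->.
by rewrite (negPf ab) eq_sym (negPf ca).
Qed.

Lemma enum_set2 (T : finType) (b c : T) : b != c ->
  enum [set b; c] = [:: b; c] \/ enum [set b; c] = [:: c; b].
Proof.
move=> bc; have := enum_uniq [set b; c]; have : size (enum [set b; c]) = 2.
  by rewrite -cardE cards2 bc.
have : forall x, x \in enum [set b; c] -> x = b \/ x = c.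
  by move=> x; rewrite mem_enum !inE => /orP[] /eqP; [left|right].
case: (enum _) => [|u [|w [|]]] //= h _; rewrite inE andbT => uw.
case: (h u); rewrite ?inE ?eqxx // => eu; case: (h w); rewrite ?inE ?eqxx ?orbT // => ew;
  subst; rewrite ?eqxx // in uw *; by [left|right].
Qed.

Lemma big_set3 (T : finType) (R : Type) (idx : R) (op : Monoid.com_law idx)
    (f : T -> R) (a b c : T) : a != b -> b != c -> c != a ->
  \big[op/idx]_(v in [set a; b; c]) f v = op (f a) (op (f b) (f c)).
Proof.
move=> ab bc ca; rewrite -finset.setUA big_setU1 /=; last first.
  by rewrite !inE negb_or ab eq_sym ca.
by rewrite big_setU1 /= ?inE // big_set1.
Qed.

(** * Angles in the triangulation, the maximum principle and injectivity *)

Section Triangles.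
Context {V : finType} {tri : {set {set V}}} {R : realType} {Theta : {set V} -> R}.
Hypothesis surf : is_surface_triangulation tri.
Hypothesis Theta_bound : forall e, e \in edges tri -> 0 <= Theta e < pi.
Hypothesis c1 : C1 tri Theta.

Definition ordered_tri a b c : Prop :=
  [/\ [set a; b; c] \in tri, a != b, b != c & c != a].

Lemma ordered_tri_rot a b c : ordered_tri a b c -> ordered_tri b c a.
Proof. by case=> t ab bc ca; split => //; rewrite -set3_rot. Qed.

Lemma ordered_triC a b c : ordered_tri a b c -> ordered_tri a c b.
Proof. by case=> t ab bc ca; split; rewrite 1?set3C // eq_sym. Qed.

Lemma tri_order t a : t \in tri -> a \in t ->
  exists b c, t = [set a; b; c] /\ ordered_tri a b c.
Proof.
move=> tt at_; have [[_ card3 _ _] _] := surf.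
have : #|t :\ a| = 2%N by move: (card3 _ tt); rewrite (cardsD1 a) at_ => -[].
move=> /eqP /cards2P [b [c [bc e]]].
have E : t = [set a; b; c] by rewrite -finset.setUA -e finset.setD1K.
exists b, c; split => //; split; rewrite -?E //.
  have : b \in t :\ a by rewrite e !inE eqxx.
  by rewrite !inE eq_sym => /andP[].
have : c \in t :\ a by rewrite e !inE eqxx orbT.
by rewrite !inE => /andP[].
Qed.

Lemma ordered_tri_edge a b c : ordered_tri a b c -> [set b; c] \in edges tri.
Proof.
case=> t ab bc ca; rewrite inE cards2 bc /=; apply/existsP; exists [set a; b; c].
by rewrite t; apply/fintype.subsetP => x; rewrite !inE => /orP[] ->; rewrite ?orbT.
Qed.

Lemma cos_Theta_bound e : e \in edges tri -> -1 < cos (Theta e) <= 1.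
Proof.
move=> /Theta_bound /andP[h0 h1]; rewrite cos_le1 andbT -cospi.
by rewrite ltr_cos // in_itv /= ?h0 ?pi_ge0 ?lexx // ltW.
Qed.

Notation ct a b := (cos (Theta [set a; b])).

Lemma ordered_tri_admissible a b c : ordered_tri a b c ->
  admissible (ct b c) (ct c a) (ct a b).
Proof.
move=> o; split.
  split; apply: cos_Theta_bound; first exact: ordered_tri_edge o.
    exact: ordered_tri_edge (ordered_tri_rot _ _ _ o).
  exact: ordered_tri_edge (ordered_tri_rot _ _ _ (ordered_tri_rot _ _ _ o)).
have [t ab bc ca] := o.
by have := c1 _ t a b c erefl ab bc; rewrite eq_sym => /(_ ca).
Qed.

(** The enumeration may list the other two vertices in either order; [angC] reconciles them. Radii
    may vanish, so that the formula applies to limits of radii. *)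
Lemma tri_angleE r a b c : (forall v, 0 <= r v) -> ordered_tri a b c ->
  tri_angle Theta r [set a; b; c] a = ang (ct b c) (ct c a) (ct a b) (r a) (r b) (r c).
Proof.
move=> r0 o; have [t ab bc ca] := o.
have adm := ordered_tri_admissible _ _ _ o; have [[/andP[hp _] /andP[hq _] /andP[hr _]] _] := adm.
have elenE u v : elen Theta r u v = Num.sqrt (len2 (r u) (r v) (ct u v)) by [].
have elen_sqr u v : -1 < ct u v -> elen Theta r u v ^+ 2 = len2 (r u) (r v) (ct u v).
  by move=> h; rewrite elenE sqr_sqrtr // len2_ge0.
have key u w : -1 < ct u w -> -1 < ct w a -> -1 < ct a u ->
  (elen Theta r a u ^+ 2 + elen Theta r a w ^+ 2 - elen Theta r u w ^+ 2)
        / (2 * elen Theta r a u * elen Theta r a w)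
  = ang_cos (ct u w) (ct w a) (ct a u) (r a) (r u) (r w).
  move=> h1 h2 h3; rewrite !elen_sqr 1?(finset.setUC [set a] [set w]) //.
  rewrite !elenE 1?(finset.setUC [set a] [set w]) /ang_cos -[2 * _ * _]mulrA invfM mulrA.
  congr (_ * _); apply: (@mulIf _ 2); first by rewrite pnatr_eq0.
  by rewrite divfK ?pnatr_eq0 // /len2; ring.
rewrite /tri_angle set3D1 //; case: (enum_set2 _ _ _ bc) => -> /=.
  by rewrite key.
rewrite key 1?(finset.setUC [set c]) 1?(finset.setUC [set b] [set a]) 1?(finset.setUC [set a] [set c]) //.
by rewrite [RHS]angC.
Qed.

Lemma tri_angle_gt0 r t v : (forall v, 0 < r v) -> t \in tri -> v \in t ->
  0 < tri_angle Theta r t v.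
Proof.
move=> r0 tt vt; have [b [c [-> o]]] := tri_order _ _ tt vt.
rewrite tri_angleE //; last by move=> ?; exact: ltW.
exact: ang_gt0 (ordered_tri_admissible _ _ _ o) _ _ _.
Qed.

Lemma tri_angle_sum r t : (forall v, 0 < r v) -> t \in tri ->
  \sum_(v in t) tri_angle Theta r t v = pi.
Proof.
move=> r0 tt; have [[_ card3 _ _] _] := surf.
have /card_gt0P[a at_] : (0 < #|t|)%N by rewrite card3.
have [b [c [-> o]]] := tri_order _ _ tt at_.
have o' := ordered_tri_rot _ _ _ o; have o'' := ordered_tri_rot _ _ _ o'.
have r0' v : 0 <= r v by exact: ltW.
have [_ ab bc ca] := o; rewrite big_set3 //= tri_angleE // set3_rot tri_angleE //.
rewrite set3_rot tri_angleE // addrA; apply: ang_sum => //.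
exact: ordered_tri_admissible.
Qed.

Lemma tri_angle_max r r' t a : (forall v, 0 < r v) -> (forall v, 0 < r' v) ->
  t \in tri -> a \in t -> (forall v, r' v * r a <= r v * r' a) ->
  tri_angle Theta r' t a <= tri_angle Theta r t a.
Proof.
move=> r0 r'0 tt at_ h; have [b [c [-> o]]] := tri_order _ _ tt at_.
rewrite !tri_angleE //; try by move=> ?; exact: ltW.
by apply: ang_max => //; exact: ordered_tri_admissible.
Qed.

Lemma tri_angle_max_strict r r' a b c : (forall v, 0 < r v) -> (forall v, 0 < r' v) ->
  ordered_tri a b c -> flexible (ct b c) (ct c a) (ct a b) ->
  (forall v, r' v * r a <= r v * r' a) -> r' b * r a < r b * r' a ->
  tri_angle Theta r' [set a; b; c] a < tri_angle Theta r [set a; b; c] a.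
Proof.
move=> r0 r'0 o fl h hb.
rewrite !tri_angleE //; try by move=> ?; exact: ltW.
by apply: ang_max_strict => //; exact: ordered_tri_admissible.
Qed.

(** Connectedness gives an edge from [a] in [B] to [b] outside. If it is not flexible, the cosines
    on the other two edges of a triangle through it have sum at most 0 and exceed -1, so both are
    below 1. Whichever side the third vertex [c] lies on, one of those two edges crosses and is
    flexible. *)
Lemma flexible_crossing (B : {set V}) x y : x \in B -> y \notin B ->
  exists a b c, [/\ ordered_tri a b c, flexible (ct b c) (ct c a) (ct a b),
                    a \in B & b \notin B].
Proof.
move=> xB yB; have [_ [_ conn _]] := surf.
have [a [b [/andP[ab /existsP[t /and3P[tt at_ bt]]] aB bB]]] :=
  connect_crossing _ _ _ _ _ (conn x y) xB yB.
have [c [d [te o]]] := tri_order _ _ tt at_.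
have {t tt te at_ bt c d o} [c o] : exists c, ordered_tri a b c.
  move: bt; rewrite te !inE eq_sym (negPf ab) /= => /orP[]/eqP ->; first by exists d.
  by exists c; exact: ordered_triC.
have [[hp hq hr] _] := ordered_tri_admissible _ _ _ o.
have [fl|] := boolP (flexible (ct b c) (ct c a) (ct a b)); first by exists a, b, c.
rewrite /flexible negb_or -!leNgt => /andP[r1 pq].
have [cB|cB] := boolP (c \in B).
  exists c, b, a; split => //.
    exact: ordered_tri_rot (ordered_triC _ _ _ o).
  by apply/orP; left; rewrite finset.setUC; lra.
exists a, c, b; split => //; first exact: ordered_triC.
by apply/orP; left; rewrite finset.setUC; lra.
Qed.

Lemma cone_angle_max r r' a : (forall v, 0 < r v) -> (forall v, 0 < r' v) ->
  (forall v, r' v * r a <= r v * r' a) -> cone_angle tri Theta r' a <= cone_angle tri Theta r a.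
Proof. by move=> r0 r'0 h; apply: ler_sum => t /andP[tt at_]; exact: tri_angle_max. Qed.

Lemma cone_angle_max_strict r r' a b c : (forall v, 0 < r v) -> (forall v, 0 < r' v) ->
  ordered_tri a b c -> flexible (ct b c) (ct c a) (ct a b) ->
  (forall v, r' v * r a <= r v * r' a) -> r' b * r a < r b * r' a ->
  cone_angle tri Theta r' a < cone_angle tri Theta r a.
Proof.
move=> r0 r'0 o fl h hb; have [tt _ _ _] := o.
have at_ : a \in [set a; b; c] by rewrite !inE eqxx.
rewrite /cone_angle (bigD1 [set a; b; c]) ?tt // [ltRHS](bigD1 [set a; b; c]) ?tt //=.
apply: ltr_leD; first exact: tri_angle_max_strict.
by apply: ler_sum => t /andP[/andP[? ?] _]; exact: tri_angle_max.
Qed.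

Lemma cone_angle_gt0 r v : (forall v, 0 < r v) -> 0 < cone_angle tri Theta r v.
Proof.
move=> r0; have [[_ _ cov _] _] := surf; have [t tt vt] := cov v.
rewrite /cone_angle (bigD1 t) ?tt //=; apply: ltr_wpDr; last exact: tri_angle_gt0.
by apply: sumr_ge0 => s /andP[/andP[? ?] _]; apply: ltW; exact: tri_angle_gt0.
Qed.

Lemma cone_angle_inj r r' : (forall v, 0 < r v) -> (forall v, 0 < r' v) ->
  (forall v, cone_angle tri Theta r v = cone_angle tri Theta r' v) ->
  exists2 c : R, 0 < c & r' = (fun v => c * r v).
Proof.
move=> r0 r'0 E; have [[tri0 card3 _ _] _] := surf; have [t0 t0t] := finset.set0Pn _ tri0.
have /card_gt0P[v0 _] : (0 < #|t0|)%N by rewrite card3.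
pose f v := r' v / r v.
have [a _ amax] := @arg_maxP _ R V v0 predT f isT.
have fle j : f j <= f a by exact: amax.
exists (f a); first by rewrite divr_gt0.
(* [B] is where [r' v / r v] is maximal. Were it not everything, a flexible edge leaving [B] would
   make the cone angle at its endpoint in [B] strictly smaller for [r'] than for [r]. *)
pose B := ([set v | f v == f a]%SET).
suff BT v : v \in B.
  by apply: funext => v; move: (BT v); rewrite inE => /eqP <-; rewrite divfK ?gt_eqF.
apply/negPn/negP => vB.
have aB : a \in B by rewrite inE.
have [a' [b [c [ot fl a'B bB]]]] := flexible_crossing _ _ _ aB vB.
rewrite inE in a'B; rewrite inE in bB.
have h u : r' u * r a' <= r u * r' a'.
  have : f u <= f a' by rewrite (eqP a'B) fle.
  by rewrite /f ler_pdivrMr // mulrAC ler_pdivlMr // [leRHS]mulrC.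
have hb : r' b * r a' < r b * r' a'.
  have : f b < f a' by rewrite (eqP a'B) lt_neqAle bB fle.
  by rewrite /f ltr_pdivrMr // mulrAC ltr_pdivlMr // [ltRHS]mulrC.
have := cone_angle_max_strict _ _ _ _ _ r0 r'0 ot fl h hb.
by rewrite E ltxx.
Qed.

End Triangles.

Arguments ordered_tri {V} tri a b c.

(** * Capacities of vertex sets, Euler characteristics and the necessity of the inequalities *)

Lemma card_setI_sum (T : finType) (t A : {set T}) : #|t :&: A| = (\sum_(v in t) (v \in A))%N.
Proof.
rewrite -sum1_card [RHS](eq_bigr (fun v => if v \in A then 1 else 0)%N); last first.
  by move=> v _; case: (v \in A).
by rewrite -big_mkcondr; apply: eq_bigl => v; rewrite inE.
Qed.

Lemma sum_setI (T : finType) (R : realType) (f : T -> R) (t A : {set T}) :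
  \sum_(v in t :&: A) f v = \sum_(v in t) if v \in A then f v else 0.
Proof. by rewrite -big_mkcondr; apply: eq_bigl => v; rewrite inE. Qed.

Section AngleCapacity.
Context {V : finType} {tri : {set {set V}}} {R : realType} {Theta : {set V} -> R}.
Hypothesis surf : is_surface_triangulation tri.
Hypothesis Theta_bound : forall e, e \in edges tri -> 0 <= Theta e < pi.
Hypothesis c1 : C1 tri Theta.

(* The supremum, over all radii, of the total angle of [t] at its vertices in [A]; it is
   approached when the radii on [A] shrink to 0. *)
Definition capacity (A t : {set V}) : R :=
  if (1 < #|t :&: A|)%N then pi else \sum_(v in t :&: A) (pi - Theta (t :\ v)).

Lemma card_triD1 (t : {set V}) v : t \in tri -> v \in t -> #|t :\ v| = 2%N.
Proof.
move=> tt vt; have [[_ card3 _ _] _] := surf.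
by have /eqP := card3 _ tt; rewrite (cardsD1 v) vt add1n eqSS => /eqP.
Qed.

(** Double counting of incidences between triangles and edges meeting [A]: an interior edge lies in
    two triangles, a boundary edge in one. *)
Lemma edge_count (A : {set V}) :
  (#|[set e in edges tri | ~~ bd_edge tri e & ~~ [disjoint e & A]]| * 2
   + #|[set e in edges tri | bd_edge tri e & ~~ [disjoint e & A]]|
  = \sum_(t in tri) #|[set e in edges tri | e \subset t & ~~ [disjoint e & A]]|)%N.
Proof.
have [[_ _ _ nt] _] := surf.
transitivity (\sum_(e in edges tri | ~~ [disjoint e & A]) ntri tri e)%N.
  rewrite (bigID (bd_edge tri)) /= addnC; congr (_ + _)%N.
    rewrite -sum1_card; apply: eq_big => e.
      by rewrite [LHS]inE; case: (e \in edges tri) => //=; rewrite andbC.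
    by rewrite inE => /and3P[_ /andP[_ /eqP ->]].
  rewrite -sum1_card big_distrl /=; apply: eq_big => e.
    by rewrite [LHS]inE; case: (e \in edges tri) => //=; rewrite andbC.
  rewrite inE => /and3P[eE]; rewrite /bd_edge eE /=.
  by case: (nt _ eE) => ->.
transitivity (\sum_(t in tri) \sum_(e in edges tri | ~~ [disjoint e & A] && (e \subset t)) 1)%N.
  rewrite (exchange_big_dep (fun e => (e \in edges tri) && ~~ [disjoint e & A])) /=; last first.
    by move=> t e _ /and3P[-> ->].
  apply: eq_bigr => e /andP[eE eA]; rewrite /ntri -sum1_card; apply: eq_bigl => t.
  by rewrite [LHS]inE eE eA.
apply: eq_bigr => t _; rewrite sum1_card; apply: eq_card => e.
by rewrite unfold_in [RHS]inE; case: (e \in edges tri) => //=; rewrite andbC.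
Qed.

(** The edges of a triangle are parametrized by their opposite vertices. *)
Lemma tri_edge_count (A t : {set V}) : t \in tri ->
  #|[set e in edges tri | e \subset t & ~~ [disjoint e & A]]|
  = (\sum_(v in t) ~~ [disjoint (t :\ v) & A])%N.
Proof.
move=> tt; have [[_ card3 _ _] _] := surf.
have -> : [set e in edges tri | e \subset t & ~~ [disjoint e & A]]
   = [set t :\ v | v in [set v in t | ~~ [disjoint (t :\ v) & A]]].
  apply/finset.setP => e; rewrite !inE; apply/idP/imsetP.
    move=> /and3P[/andP[/eqP e2 _] et eA].
    have : #|t :\: e| = 1%N by rewrite cardsD (finset.setIidPr et) card3 // e2.
    move=> /eqP /cards1P [v tev].
    have eE : e = t :\ v.
      by rewrite -tev finset.setDDr finset.setDv finset.set0U; apply/esym/finset.setIidPr.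
    exists v => //; rewrite !inE -eE eA andbT.
    have : v \in t :\: e by rewrite tev inE.
    by rewrite inE => /andP[].
  move=> [v]; rewrite !inE => /andP[vt vA] ->.
  rewrite (card_triD1 _ _ tt vt) vA subsetDl !andbT eqxx /=.
  by apply/existsP; exists t; rewrite tt subsetDl.
rewrite card_in_imset; last first.
  move=> v w; rewrite !inE => /andP[vt _] /andP[wt _] /finset.setP /(_ v).
  by rewrite !inE eqxx vt andbT /=; case: eqVneq.
rewrite -sum1_card [RHS]big_mkcond [LHS]big_mkcond /=; apply: eq_bigr => v _.
by rewrite !inE; case: (v \in t) => //=; case: [disjoint _ & _].
Qed.

(** A pair [(e, v)] of the link corresponds to the triangle [v |: e] with its marked vertex [v], and
    [e] is recovered as [t :\ v]. *)
Lemma link_sumE (A : {set V}) : link_sum tri Theta A =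
  \sum_(t in tri) \sum_(v in t) (if (v \in A) && [disjoint (t :\ v) & A] then pi - Theta (t :\ v) else 0).
Proof.
rewrite /link_sum.
transitivity (\sum_(v in A) \sum_(e | [&& e \in edges tri, [disjoint e & A] & v |: e \in tri]) (pi - Theta e)).
  rewrite (exchange_big_dep (mem A)) /=; last by move=> e v _ /andP[].
  by apply: eq_bigr => v vA; apply: eq_bigl => e; rewrite vA.
transitivity (\sum_(v in A) \sum_(t in tri | (v \in t) && [disjoint (t :\ v) & A]) (pi - Theta (t :\ v))).
  apply: eq_bigr => v vA.
  rewrite (reindex_onto (fun t => t :\ v) (fun e => v |: e)) /=; last first.
    move=> e /and3P[_ eA _]; rewrite setU1K //; apply/negP => ve.
    by move: eA; rewrite disjoint_subset => /fintype.subsetP/(_ _ ve); rewrite inE vA.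
  apply: eq_bigl => t; have [vt|vt] := boolP (v \in t); last first.
    rewrite andbF; apply/negP => /andP[_ /eqP E].
    by move: vt; rewrite -E !inE eqxx.
  rewrite finset.setD1K // eqxx andbT /=; case tt: (t \in tri); rewrite ?andbF //= andbT.
  suff -> : t :\ v \in edges tri by [].
  rewrite inE (card_triD1 _ _ tt vt) /=.
  by apply/existsP; exists t; rewrite tt subsetDl.
rewrite (exchange_big_dep (mem tri)) /=; last by move=> v t _ /andP[].
apply: eq_bigr => t tt; rewrite -big_mkcondr /=; apply: eq_bigl => v.
by rewrite tt; case: (v \in A); case: (v \in t).
Qed.

(** With one vertex in [A], two edges meet [A], so [2 * pi - 2 * pi] leaves the link term. With two
    or three, all three edges meet [A], the link term vanishes and [3 * pi - 2 * pi = pi]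
    remains. *)
Lemma capacityE (A t : {set V}) : t \in tri ->
  capacity A t =
   \sum_(v in t) (if (v \in A) && [disjoint (t :\ v) & A] then pi - Theta (t :\ v) else 0)
   + pi * (\sum_(v in t) ~~ [disjoint (t :\ v) & A])%N%:R
   - 2 * pi * (~~ [disjoint t & A])%:R.
Proof.
move=> tt; have [[_ card3 _ _] _] := surf.
have /card_gt0P[a at_] : (0 < #|t|)%N by rewrite card3.
have [b [c [tE o]]] := tri_order surf _ _ tt at_.
have [_ ab bc ca] := o.
have disU (B C : {set V}) : [disjoint B :|: C & A] = [disjoint B & A] && [disjoint C & A].
  by rewrite -!finset.setI_eq0 finset.setIUl finset.setU_eq0.
rewrite /capacity card_setI_sum sum_setI.
rewrite tE !big_set3 //=.
have Db : [set a; b; c] :\ b = [set c; a] by rewrite set3_rot set3D1.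
have Dc : [set a; b; c] :\ c = [set a; b] by rewrite -set3_rot set3D1.
rewrite set3D1 // Db Dc.
rewrite !disU !disjoints1.
by case: (a \in A); case: (b \in A); case: (c \in A) => /=; ring.
Qed.

(** The vertex terms cancel. Edges contribute [2 * pi] if interior and [pi] if on the boundary, that
    is [pi] per incident triangle, and each triangle meeting [A] contributes [- 2 * pi]; this is
    [capacityE] summed over triangles. *)
Lemma capacity_sum (A : {set V}) :
  \sum_(v in A) (if bd_vertex tri v then pi else 2 * pi)
  - (- link_sum tri Theta A + 2 * pi * (chi_int tri A)%:~R + pi * (chi_bd tri A)%:~R)
  = \sum_(t in tri) capacity A t.
Proof.
rewrite (eq_bigr _ (capacityE A)) sumrB big_split /= -link_sumE -!mulr_sumr -!natr_sum.
have -> : (\sum_(t in tri) \sum_(v in t) ~~ [disjoint t :\ v & A])%N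
   = (\sum_(t in tri) #|[set e in edges tri | e \subset t & ~~ [disjoint e & A]]|)%N.
  by apply: eq_bigr => t tt; rewrite tri_edge_count.
rewrite -edge_count.
have -> : (\sum_(t in tri) ~~ [disjoint t & A])%N = #|[set t in tri | ~~ [disjoint t & A]]|.
  rewrite -sum1_card [LHS]big_mkcond [RHS]big_mkcond /=; apply: eq_bigr => t _.
  by rewrite !inE; case: (t \in tri) => //=; case: [disjoint _ & _].
have -> : \sum_(v in A) (if bd_vertex tri v then pi else 2 * pi) =
   pi * #|[set v in A | bd_vertex tri v]|%:R + 2 * pi * #|[set v in A | ~~ bd_vertex tri v]|%:R :> R.
  rewrite (bigID (bd_vertex tri)) /=; congr (_ + _).
    rewrite -sum1_card natr_sum mulr_sumr; apply: eq_big => v; first by rewrite !inE.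
    by move=> /andP[_ ->]; rewrite mulr1.
  rewrite -sum1_card natr_sum mulr_sumr; apply: eq_big => v; first by rewrite !inE.
  by move=> /andP[_ /negPf ->]; rewrite mulr1.
rewrite natrD natrM /chi_int /chi_bd !(rmorphD, rmorphB) /= -!pmulrn.
by ring.
Qed.

Lemma sum_cone_angle r (A : {set V}) : \sum_(v in A) cone_angle tri Theta r v =
  \sum_(t in tri) \sum_(v in t :&: A) tri_angle Theta r t v.
Proof.
rewrite /cone_angle (exchange_big_dep (mem tri)) /=; last by move=> v t _ /andP[].
apply: eq_bigr => t tt; apply: eq_bigl => v; by rewrite inE tt andbC.
Qed.

Lemma sum_cone_angleT r : (forall v, 0 < r v) ->
  \sum_(v in [set: V]) cone_angle tri Theta r v = \sum_(t in tri) capacity [set: V] t.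
Proof.
move=> r0; have [[_ card3 _ _] _] := surf.
rewrite sum_cone_angle; apply: eq_bigr => t tt.
by rewrite /capacity finset.setIT card3 // (tri_angle_sum surf Theta_bound c1).
Qed.

Lemma tri_angle_lt_apex r t v : (forall v, 0 < r v) -> t \in tri -> v \in t ->
  tri_angle Theta r t v < pi - Theta (t :\ v).
Proof.
move=> r0 tt vt; have [b [c [-> o]]] := tri_order surf _ _ tt vt.
have [_ ab bc ca] := o.
rewrite (tri_angleE Theta_bound c1) // ?set3D1 //; last by move=> ?; exact: ltW.
apply: ang_lt_apex => //; first exact: (ordered_tri_admissible Theta_bound c1).
by apply: Theta_bound; exact: ordered_tri_edge o.
Qed.

Lemma sum_tri_angle_le_capacity r (A t : {set V}) : (forall v, 0 < r v) -> t \in tri ->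
  \sum_(v in t :&: A) tri_angle Theta r t v <= capacity A t.
Proof.
move=> r0 tt; rewrite /capacity; case: ifP => _.
  rewrite -(tri_angle_sum surf Theta_bound c1 _ _ r0 tt) [leRHS](big_setID A) /= lerDl.
  apply: sumr_ge0 => v; rewrite inE => /andP[_ vt].
  exact/ltW/(tri_angle_gt0 surf Theta_bound c1).
by apply: ler_sum => v; rewrite inE => /andP[vt _]; exact/ltW/tri_angle_lt_apex.
Qed.

(** With two vertices in [A], the positive angle at [b] is missing from pi; otherwise the angle at
    [a] is strictly below its apex bound. *)
Lemma sum_tri_angle_lt_capacity r (A t : {set V}) a b : (forall v, 0 < r v) -> t \in tri ->
  a \in t :&: A -> b \in t :\: A ->
  \sum_(v in t :&: A) tri_angle Theta r t v < capacity A t.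
Proof.
move=> r0 tt aA bA; rewrite /capacity; case: ifP => _.
  rewrite -(tri_angle_sum surf Theta_bound c1 _ _ r0 tt) [ltRHS](big_setID A) /= ltrDl.
  rewrite (bigD1 b) //=; apply: ltr_wpDr.
    apply: sumr_ge0 => v /andP[+ _]; rewrite inE => /andP[_ vt].
    exact/ltW/(tri_angle_gt0 surf Theta_bound c1).
  by move: bA; rewrite inE => /andP[_ bt]; exact: (tri_angle_gt0 surf Theta_bound c1).
rewrite (bigD1 a) // [ltRHS](bigD1 a) //=; apply: ltr_leD.
  by move: aA; rewrite inE => /andP[at_ _]; exact: tri_angle_lt_apex.
apply: ler_sum => v /andP[+ _]; rewrite inE => /andP[vt _]; exact/ltW/tri_angle_lt_apex.
Qed.

Lemma sum_cone_angle_lt r (A : {set V}) : (forall v, 0 < r v) ->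
  A != finset.set0 -> A != [set: V] ->
  \sum_(v in A) cone_angle tri Theta r v < \sum_(t in tri) capacity A t.
Proof.
move=> r0 /finset.set0Pn[x xA] AT.
have [y yA] : exists y, y \notin A.
  by move: AT; rewrite -finset.subTset => /subsetPn[y _ yA]; exists y.
have [a [b [c [ot _ aA bA]]]] := flexible_crossing surf Theta_bound c1 _ _ _ xA yA.
have [tt _ _ _] := ot.
rewrite sum_cone_angle (bigD1 [set a; b; c]) // [ltRHS](bigD1 [set a; b; c]) //=.
apply: ltr_leD.
  apply: (sum_tri_angle_lt_capacity _ _ _ a b) => //.
    by rewrite !inE eqxx aA.
  by rewrite !inE eqxx orbT bA.
by apply: ler_sum => t /andP[? _]; exact: sum_tri_angle_le_capacity.
Qed.

End AngleCapacity.
Arguments capacity {V R} Theta A t.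

(** * Limits along ultrafilters and finite minima *)

Section FilterLemmas.
Local Open Scope classical_set_scope.

Lemma fmap_ultra {T U : Type} (f : T -> U) (F : set_system T) :
  UltraFilter F -> UltraFilter (f @ F).
Proof.
move=> UF; split; first exact: fmap_proper_filter.
move=> G PG FG; apply/seteqP; split => [B GB|]; last exact: FG.
case: (in_ultra_setVsetC (f @^-1` B) UF) => // FB.
have GC : G (~` B) by apply: FG.
have /filter_ex[x []] : G (B `&` ~` B) by exact: filterI.
by move=> ? [].
Qed.

Lemma cvg_finsum {R : realType} {T : Type} {F : set_system T} {FF : Filter F}
    {I : finType} (P : pred I) (f : T -> I -> R) (l : I -> R) :
  (forall i, P i -> f t i @[t --> F] --> l i) ->
  \sum_(i | P i) f t i @[t --> F] --> \sum_(i | P i) l i.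
Proof.
move=> h; elim: (index_enum I) => [|i s IH].
  by rewrite big_nil; under eq_fun do rewrite big_nil; exact: cvg_cst.
rewrite big_cons; under eq_fun do rewrite big_cons.
by case: ifP => Pi //; apply: cvgD => //; exact: h.
Qed.

(** Compactness of the segment. One ultrafilter makes all bounded families converge at once, in
    place of extracting subsequences vertex by vertex. *)
Lemma ultra_bounded_cvg {R : realType} {T : Type} {F : set_system T} (f : T -> R) a b :
  UltraFilter F -> (forall t, a <= f t <= b) -> exists2 l, a <= l <= b & f t @[t --> F] --> l.
Proof.
move=> UF hf; have /= := @segment_compact R a b; rewrite compact_ultra /= => /(_ (f @ F)).
case; first exact: fmap_ultra.
  suff : F (f @^-1` `[a, b]) by [].
  by apply: filterE => t /=; rewrite in_itv /=; exact: hf.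
by move=> l [/= lab cl]; exists l => //; rewrite in_itv /= in lab.
Qed.

End FilterLemmas.

Lemma finite_margin {R : realType} {I : finType} (P : pred I) (g : I -> R) :
  (forall i, P i -> 0 < g i) -> exists2 d : R, 0 < d & forall i, P i -> d <= g i.
Proof.
move=> h; exists (\big[Num.min/1]_(i | P i) g i); first exact: lt_bigmin.
by move=> i Pi; exact: bigmin_le_cond.
Qed.

(** * Cone angles along converging radii, some of which may collapse *)

Section Existence.
Context {V : finType} {tri : {set {set V}}} {R : realType} {Theta : {set V} -> R}.
Hypothesis surf : is_surface_triangulation tri.
Hypothesis Theta_bound : forall e, e \in edges tri -> 0 <= Theta e < pi.
Hypothesis c1 : C1 tri Theta.
Local Open Scope classical_set_scope.

Let capsum (A : {set V}) : R := \sum_(t in tri) capacity Theta A t.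

Section LimitsOfRadii.
Context {T : Type} {F : set_system T} {FF : Filter F}.
Variables (rho : T -> V -> R) (l : V -> R).
Hypothesis rho_gt0 : forall i v, 0 < rho i v.
Hypothesis l_ge0 : forall v, 0 <= l v.
Hypothesis rho_cvg : forall v, rho i v @[i --> F] --> l v.

Lemma tri_angle_cvg a b c : ordered_tri tri a b c -> 0 < l a \/ 0 < l b /\ 0 < l c ->
  tri_angle Theta (rho i) [set a; b; c]%SET a @[i --> F] --> tri_angle Theta l [set a; b; c]%SET a.
Proof.
move=> ot pos; have rho_ge0 i v : 0 <= rho i v by exact: ltW.
rewrite (tri_angleE Theta_bound c1) //.
under eq_fun do rewrite (tri_angleE Theta_bound c1) //.
by apply: ang_cvg => //; exact: (ordered_tri_admissible Theta_bound c1).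
Qed.

Lemma cone_angle_cvg v : (forall v, 0 < l v) ->
  cone_angle tri Theta (rho i) v @[i --> F] --> cone_angle tri Theta l v.
Proof.
move=> l0; apply: cvg_finsum => t /andP[tt vt].
have [b [c [-> ot]]] := tri_order surf _ _ tt vt.
by apply: tri_angle_cvg => //; left.
Qed.

(** The cases follow the number of collapsing vertices of [t]. With three, the sum is constantly pi;
    otherwise some vertex [c] keeps a positive limit radius and serves as reference. *)
Lemma tri_angle_sum_cvg t (A := [set v | l v == 0]%SET) : t \in tri ->
  \sum_(v in t :&: A) tri_angle Theta (rho i) t v @[i --> F] --> capacity Theta A t.
Proof.
move=> tt; have [[_ card3 _ _] _] := surf.
have [tA|/subsetPn[c ct cA]] := boolP (t \subset A).
  rewrite /capacity (finset.setIidPl tA) card3 //=.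
  under eq_fun do rewrite (tri_angle_sum surf Theta_bound c1) //.
  exact: cvg_cst.
have [a [b [tE ot]]] := tri_order surf _ _ tt ct.
have [_ ca ab bc] := ot.
have o' := ordered_tri_rot _ _ _ ot; have o'' := ordered_tri_rot _ _ _ o'.
have pos x : x \notin A -> 0 < l x by rewrite inE lt_neqAle eq_sym => ->; rewrite l_ge0.
have zero x : x \in A -> l x = 0 by rewrite inE => /eqP.
have Da : t :\ a = [set b; c]%SET by rewrite tE set3_rot set3D1 // eq_sym.
have Db : t :\ b = [set c; a]%SET by rewrite tE -set3_rot set3D1 // eq_sym.
have apex x y z : ordered_tri tri x y z -> x \in A -> y \notin A -> z \notin A ->
    tri_angle Theta (rho i) [set x; y; z]%SET x @[i --> F] --> pi - Theta [set y; z]%SET.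
  move=> o xA yA zA.
  have <- : tri_angle Theta l [set x; y; z]%SET x = pi - Theta [set y; z]%SET.
    rewrite (tri_angleE Theta_bound c1) // zero //; apply: ang_apex0; rewrite ?pos //.
    exact/Theta_bound/(ordered_tri_edge _ _ _ o).
  by apply: tri_angle_cvg => //; right; rewrite !pos.
have sumE (f : V -> R) : \sum_(v in t :&: A) f v =
    (if a \in A then f a else 0) + (if b \in A then f b else 0).
  by rewrite sum_setI {1}tE big_set3 //= (negPf cA) add0r.
have cardE : #|t :&: A| = ((a \in A) + (b \in A))%N.
  by rewrite card_setI_sum tE big_set3 //= (negPf cA) add0n.
rewrite /capacity cardE sumE Da Db.
under eq_fun do rewrite sumE.
have [aA|aA] := boolP (a \in A); have [bA|bA] := boolP (b \in A) => /=.
(* The lemmas above give no separate limits for the angles at [a] and [b], but their sum is pi minus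
   the angle at [c], which tends to 0 as its opposite side collapses. *)
- under eq_fun => i.
    rewrite (_ : _ + _ = pi - tri_angle Theta (rho i) t c); last first.
      rewrite -(tri_angle_sum surf Theta_bound c1 _ _ (rho_gt0 i) tt) [in RHS]tE big_set3 //= -tE.
      by ring.
    over.
  have h0 : tri_angle Theta (rho i) t c @[i --> F] --> 0.
    have <- : tri_angle Theta l t c = 0.
      by rewrite tE (tri_angleE Theta_bound c1) // (zero _ aA) (zero _ bA) ang_opposite0 // pos.
    by rewrite tE; apply: tri_angle_cvg => //; left; exact: pos.
  by have := cvgB (cvg_cst (pi : R)) h0; rewrite subr0; apply.
- rewrite addr0; under eq_fun do rewrite addr0.
  by rewrite tE set3_rot; exact: (apex _ _ _ o').
- rewrite add0r; under eq_fun do rewrite add0r.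
  by rewrite tE -set3_rot; exact: (apex _ _ _ o'').
- by rewrite !addr0; exact: cvg_cst.
Qed.

Lemma sum_cone_angle_cvg (A := [set v | l v == 0]%SET) :
  \sum_(v in A) cone_angle tri Theta (rho i) v @[i --> F] --> capsum A.
Proof.
under eq_fun do rewrite sum_cone_angle.
by apply: cvg_finsum => t tt; exact: tri_angle_sum_cvg.
Qed.

End LimitsOfRadii.
End Existence.

(** * Realization of prescribed cone angles by lowering the parameter [m] *)

Section Realization.
Context {V : finType} {tri : {set {set V}}} {R : realType} {Theta : {set V} -> R}.
Hypothesis surf : is_surface_triangulation tri.
Hypothesis Theta_bound : forall e, e \in edges tri -> 0 <= Theta e < pi.
Hypothesis c1 : C1 tri Theta.
Variable s : V -> R.
Hypothesis s_lt : forall A : {set V}, A != finset.set0 -> A != [set: V]%SET ->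
  \sum_(v in A) s v < \sum_(t in tri) capacity Theta A t.
Hypothesis s_total : \sum_v s v = \sum_(t in tri) capacity Theta [set: V]%SET t.

Let cone r v := cone_angle tri Theta r v.
Let capsum (A : {set V}) : R := \sum_(t in tri) capacity Theta A t.

(** The ratio of the two radii is constant, so the maximum principle applies at every vertex and in
    both directions. *)
Lemma cone_angle_scale r c v : 0 < c -> (forall v, 0 < r v) ->
  cone_angle tri Theta (fun u => c * r u) v = cone_angle tri Theta r v.
Proof.
move=> c0 r0; have cr0 u : 0 < c * r u by rewrite mulr_gt0.
by apply/eqP; rewrite eq_le; apply/andP; split;
  apply: (cone_angle_max surf Theta_bound c1) => // u; rewrite mulrCA mulrA.
Qed.

Lemma sum_cone_angle_total r : (forall v, 0 < r v) -> \sum_v cone r v = \sum_v s v.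
Proof.
move=> r0; rewrite s_total -(sum_cone_angleT surf Theta_bound c1 r r0).
by apply: eq_bigl => v; rewrite inE.
Qed.

(** Having one margin for both [s] and the constant radii gives the same margin to all their convex
    combinations. *)
Lemma capacity_margin : exists2 e : R, 0 < e &
  forall A : {set V}, A != finset.set0 -> A != [set: V]%SET ->
  \sum_(v in A) s v + e <= capsum A /\ \sum_(v in A) cone (fun=> 1) v + e <= capsum A.
Proof.
pose P (A : {set V}) := (A != finset.set0) && (A != [set: V]%SET).
have [A /andP[A0 AT]|e e0 he] := @finite_margin R _ P
    (fun A => Num.min (capsum A - \sum_(v in A) s v) (capsum A - \sum_(v in A) cone (fun=> 1) v)).
  by rewrite lt_min !subr_gt0 s_lt // (sum_cone_angle_lt surf Theta_bound c1).
exists e => // A A0 AT; have := he A; rewrite /P A0 AT => /(_ isT).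
by rewrite le_min => /andP[h1 h2]; split; lra.
Qed.

Variable d : R.
Hypothesis d_gt0 : 0 < d.

(* At m = 1 the constraints [cone r <= target m] hold strictly for the constant radii; at m = 0 they
   force [cone r = s], because the total angle is fixed. *)
Definition target (m : R) v := s v + m * (cone (fun=> 1) v - s v + d).

Definition feasible m (r : V -> R) :=
  (forall v, 0 < r v) /\ (forall v, cone r v <= target m v).

Lemma target_cvg {T : Type} {F : set_system T} {FF : Filter F} (m_ : T -> R) m v :
  (m_ i @[i --> F] --> m)%classic -> (target (m_ i) v @[i --> F] --> target m v)%classic.
Proof. by move=> h; apply: cvgD; [exact: cvg_cst|apply: cvgM => //; exact: cvg_cst]. Qed.

Lemma feasible1 : feasible 1 (fun=> 1).
Proof.
split=> [_|v]; first exact: ltr01.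
rewrite /target mul1r; move: d_gt0 (cone _ v) => h x; lra.
Qed.

Lemma feasible0 r : feasible 0 r -> cone r =1 s.
Proof.
move=> [r0 h] v.
have h' u : 0 <= s u - cone r u by have := h u; rewrite /target mul0r addr0 subr_ge0.
have e : \sum_u (s u - cone r u) = 0 by rewrite sumrB sum_cone_angle_total // subrr.
have /(_ v isT) := psumr_eq0P (fun u _ => h' u) e; lra.
Qed.

Lemma sum_target m (A : {set V}) : \sum_(v in A) target m v =
  (1 - m) * \sum_(v in A) s v + m * \sum_(v in A) cone (fun=> 1) v + m * (d * #|A|%:R).
Proof.
rewrite /target big_split /= -mulr_sumr !big_split /= sumrN sumr_const -mulr_natr; ring.
Qed.

Definition tight m r := [set v | cone r v == target m v]%SET.

Lemma feasible_decrease_slack m r : 0 < m -> feasible m r -> tight m r = finset.set0 ->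
  exists2 m', 0 <= m' < m & feasible m' r.
Proof.
move=> m0 [r0 h] t0.
have hlt v : cone r v < target m v.
  rewrite lt_neqAle h andbT; apply/negP => hv.
  by have : v \in tight m r by [rewrite inE]; rewrite t0 inE.
(* These values approach [m] from below and stay nonnegative, since [harmonic n] lies in (0, 1]. *)
have hm : (m * (1 - harmonic n) @[n --> \oo] --> m)%classic.
  have := cvgM (cvg_cst m) (cvgB (cvg_cst (1 : R)) (@cvg_harmonic R)).
  by rewrite subr0 mulr1; apply.
have : (\forall n \near \oo, forall v, cone r v < target (m * (1 - harmonic n)) v)%classic.
  by apply: filter_forall => v; exact: cvgr_gt (target_cvg _ _ v hm) _ (hlt v).
move=> /filter_ex[n hn]; exists (m * (1 - harmonic n)); last first.
  by split => // v; exact: ltW.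
have := @harmonic_gt0 R n; have : harmonic n <= 1 :> R by rewrite /harmonic invf_le1 // ler1n.
move=> h1 h2; rewrite mulr_ge0 ?(ltW m0) ?subr_ge0 //=.
by rewrite gtr_pMr //; lra.
Qed.

(** All tight radii are multiplied by one factor slightly above 1. By the maximum principle no tight
    cone angle grows, and one drops strictly across a flexible edge; the slack vertices stay slack
    by continuity. *)
Lemma feasible_fewer_tight m r : 0 < m -> feasible m r -> tight m r != finset.set0 ->
  exists2 r', feasible m r' & (#|tight m r'| < #|tight m r|)%N.
Proof.
move=> m0 [r0 h] /finset.set0Pn[x xT].
(* The targets add up to the fixed total angle plus [m * d * #|V|], so equality cannot hold at every
   vertex. *)
have [y yT] : exists y, y \notin tight m r.
  apply/existsP; rewrite -negb_forall; apply/negP => /forallP all_tight.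
  have tT : tight m r = [set: V]%SET by apply/finset.setP => v; rewrite [RHS]inE all_tight.
  have := sum_target m [set: V]%SET.
  rewrite (eq_bigr (cone r)); last by move=> v _; have := all_tight v; rewrite inE => /eqP.
  have toT (f : V -> R) : \sum_(v in [set: V]%SET) f v = \sum_v f v.
    by apply: eq_bigl => v; rewrite inE.
  rewrite !toT !sum_cone_angle_total // => E.
  have V0 : (0 < #|[set: V]%SET|)%N by apply/card_gt0P; exists x; rewrite inE.
  have : 0 < m * (d * #|[set: V]%SET|%:R) by rewrite !mulr_gt0 // ltr0n.
  by lra.
have [a [b [c [ot fl aT bT]]]] := flexible_crossing surf Theta_bound c1 _ _ _ xT yT.
pose rho (n : nat) v := r v * (if v \in tight m r then 1 + harmonic n else 1).
have rho0 n v : 0 < rho n v.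
  by rewrite mulr_gt0 //; case: ifP => _ //; have := @harmonic_gt0 R n; lra.
have rho_cvg v : (rho n v @[n --> \oo] --> r v)%classic.
  rewrite /rho; case: (v \in tight m r); last by rewrite mulr1; exact: cvg_cst.
  have := cvgM (cvg_cst (r v)) (cvgD (cvg_cst (1 : R)) (@cvg_harmonic R)).
  by rewrite addr0 mulr1; apply.
have : (\forall n \near \oo, forall v, v \notin tight m r -> cone (rho n) v < target m v)%classic.
  apply: filter_forall => v; have [vT|vT] := boolP (v \in tight m r); first exact: filterE.
  have cv : (cone (rho n) v @[n --> \oo] --> cone r v)%classic.
    exact: (cone_angle_cvg surf Theta_bound c1 rho r rho0 (fun v => ltW (r0 v)) rho_cvg v r0).
  have lt : cone r v < target m v by rewrite lt_neqAle h andbT; move: vT; rewrite inE.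
  apply: (@filterS _ _ _ (fun n => cone (rho n) v < target m v)) => [n hn _ //|].
  exact: (cvgr_lt _ cv _ lt).
move=> /filter_ex[n hn].
have hmax v u : v \in tight m r -> rho n u * r v <= r u * rho n v.
  move=> vT; rewrite /rho vT -mulrA ler_pM2l // mulrC ler_pM2l //.
  by have := @harmonic_gt0 R n; case: ifP; lra.
have le v : v \in tight m r -> cone (rho n) v <= cone r v.
  by move=> vT; apply: (cone_angle_max surf Theta_bound c1) => // u; exact: hmax.
have lt : cone (rho n) a < cone r a.
  apply: (cone_angle_max_strict surf Theta_bound c1 _ _ _ _ _ _ _ ot) => // [u|].
    exact: hmax.
  rewrite /rho aT (negPf bT) mulr1 ltr_pM2l // mulrDr mulr1 ltrDl mulr_gt0 //.
  exact: harmonic_gt0.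
exists (rho n).
  split => // v; have [vT|vT] := boolP (v \in tight m r); last exact/ltW/hn.
  exact: le_trans (le _ vT) (h v).
apply/proper_card/properP; split.
  apply/fintype.subsetP => v; rewrite inE; apply: contraLR => vT.
  by rewrite lt_eqF // hn.
by exists a => //; rewrite inE lt_eqF // (lt_le_trans lt).
Qed.

Lemma feasible_decrease m r : 0 < m -> feasible m r ->
  exists2 m', 0 <= m' < m & exists r', feasible m' r'.
Proof.
move=> m0; have [k] := ubnP #|tight m r|; elim: k r => // k IH r hk fr.
have [t0|t0] := eqVneq (tight m r) finset.set0.
  by have [m' hm' fm'] := feasible_decrease_slack _ _ m0 fr t0; exists m' => //; exists r.
have [r' fr' lt] := feasible_fewer_tight _ _ m0 fr t0.
by apply: (IH r') => //; exact: leq_trans lt _.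
Qed.

Variable e : R.
Hypothesis e_margin : forall A : {set V}, A != finset.set0 -> A != [set: V]%SET ->
  \sum_(v in A) s v + e <= capsum A /\ \sum_(v in A) cone (fun=> 1) v + e <= capsum A.
Hypothesis d_small : d * #|V|%:R < e.

(** A limit of normalized feasible radii is feasible unless some radii collapse, and a collapse
    would force the targets on the collapsing set to reach its capacity. *)
Lemma feasible_closed (m_ : nat -> R) m : (forall n, 0 <= m_ n <= 1) ->
  (forall n, exists r, feasible (m_ n) r) -> (m_ n @[n --> \oo] --> m)%classic ->
  exists r, feasible m r.
Proof.
move=> m01 fea m_cvg.
have [[tri0 card3 _ _] _] := surf.
have [v0 _] : exists v0 : V, True.
  have /finset.set0Pn[t tt] := tri0.
  by have /card_gt0P[v _] : (0 < #|t|)%N by [rewrite card3]; exists v.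
(* Normalization bounds the radii and prevents all of them from vanishing in the limit. *)
have normalized n : exists r, feasible (m_ n) r /\ \sum_v r v = 1.
  have [r [r0 h]] := fea n.
  have S0 : 0 < \sum_v r v.
    by rewrite (bigD1 v0) //=; apply: ltr_wpDr => //; apply: sumr_ge0 => v _; exact: ltW.
  exists (fun v => (\sum_u r u)^-1 * r v); split.
    split => [v|v]; first by rewrite mulr_gt0 // invr_gt0.
    by rewrite /cone cone_angle_scale // invr_gt0.
  by rewrite -mulr_sumr mulVf // gt_eqF.
have [rho hrho] := choice normalized.
have rho_gt0 n v : 0 < rho n v by have [[]] := hrho n.
have rho_le n v : cone (rho n) v <= target (m_ n) v by have [[]] := hrho n.
have [U [UU NU]] := ultraFilterLemma (F := \oo%classic) _.
have mU : (m_ n @[n --> U] --> m)%classic by move=> B /m_cvg; exact: NU.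
have ex_lim v : exists l : R, 0 <= l /\ (rho n v @[n --> U] --> l)%classic.
  have [n|l /andP[l0 _] cl] := ultra_bounded_cvg (fun n => rho n v) 0 1 UU.
    rewrite (ltW (rho_gt0 n v)) /=; have [_ <-] := hrho n.
    by rewrite [leRHS](bigD1 v) //= lerDl; apply: sumr_ge0 => u _; exact: ltW.
  by exists l.
have [l hl] := choice ex_lim.
have l0 v : 0 <= l v by have [] := hl v.
have lc v : (rho n v @[n --> U] --> l v)%classic by have [] := hl v.
have suml : \sum_v l v = 1.
  have h : (\sum_v rho n v @[n --> U] --> \sum_v l v)%classic.
    by apply: cvg_finsum => v _; exact: lc.
  have E : (fun n => \sum_v rho n v) = fun=> 1 by apply: funext => n; rewrite (hrho n).2.
  rewrite E in h; exact: (cvg_unique (@norm_hausdorff _ _) h (cvg_cst _)).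
have mm01 : 0 <= m <= 1.
  apply/andP; split.
    by apply: (ler_cvg_to (cvg_cst _) mU); apply: filterE => n; case/andP: (m01 n).
  by apply: (ler_cvg_to mU (cvg_cst _)); apply: filterE => n; case/andP: (m01 n).
pose A := [set v | l v == 0]%SET.
have [A0|A0] := eqVneq A finset.set0.
  have l_gt0 v : 0 < l v.
    rewrite lt_neqAle l0 andbT eq_sym; apply/negP => lv.
    by have : v \in A by [rewrite inE]; rewrite A0 inE.
  exists l; split => // v.
  apply: (ler_cvg_to (cone_angle_cvg surf Theta_bound c1 rho l rho_gt0 l0 lc v l_gt0)
                     (target_cvg _ _ v mU)).
  exact: filterE.
have AT : A != [set: V]%SET.
  apply/negP => /eqP AT; have : \sum_v l v = 0.
    by apply: big1 => v _; apply/eqP; have : v \in A by [rewrite AT inE]; rewrite inE.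
  by rewrite suml; apply/eqP; rewrite oner_eq0.
have lhs : (\sum_(v in A) cone (rho n) v @[n --> U] --> capsum A)%classic.
  exact: (sum_cone_angle_cvg surf Theta_bound c1 rho l rho_gt0 l0 lc).
have rhs : (\sum_(v in A) target (m_ n) v @[n --> U] --> \sum_(v in A) target m v)%classic.
  by apply: cvg_finsum => v _; exact: target_cvg.
have h : capsum A <= \sum_(v in A) target m v.
  by apply: (ler_cvg_to lhs rhs); apply: filterE => n; exact: ler_sum.
have [h1 h2] := e_margin _ A0 AT; rewrite sum_target in h.
have cA : d * #|A|%:R < e.
  by apply: le_lt_trans d_small; rewrite ler_pM2l // ler_nat max_card.
have [ma mb] := andP mm01.
have : 0 <= d * #|A|%:R by rewrite mulr_ge0 // ltW.
move: (\sum_(v in A) s v) (\sum_(v in A) cone _ v) (capsum A) (d * #|A|%:R) h h1 h2 cA => a b q f h h1 h2 cA f0.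
(* The convex combination of [a] and [b] is at most [q - e], and adding [m * f], with [f < e],
   cannot reach [q]. *)
have : 0 <= (1 - m) * (q - e - a) by rewrite mulr_ge0; lra.
have : 0 <= m * (q - e - b) by rewrite mulr_ge0; lra.
have : 0 <= (1 - m) * f by rewrite mulr_ge0 //; lra.
by lra.
Qed.

(** The infimum of the feasible parameters is attained by [feasible_closed]; a positive infimum
    could be lowered by [feasible_decrease]. *)
Lemma feasible0_exists : exists r, feasible 0 r.
Proof.
pose E : set R := [set m | 0 <= m <= 1 /\ exists r, feasible m r]%classic.
have E1 : E 1 by split; [rewrite ler01 lexx|exists (fun=> 1); exact: feasible1].
have lbE : lbound E 0 by move=> m [/andP[]].
have hinf : has_inf E by split; [exists 1|exists 0].
have inf0 : 0 <= inf E by apply: lb_le_inf => //; exists 1.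
have inf1 : inf E <= 1 by apply: ge_inf => //; exists 0.
have app n : exists m, E m /\ m < inf E + harmonic n.
  by have [m Em mlt] := inf_adherent (@harmonic_gt0 R n) hinf; exists m.
have [m_ hm] := choice app.
have m_cvg : (m_ n @[n --> \oo] --> inf E)%classic.
  have up : (inf E + harmonic n @[n --> \oo] --> inf E)%classic.
    have := cvgD (cvg_cst (inf E)) (@cvg_harmonic R).
    by rewrite addr0; apply.
  apply: (squeeze_cvgr _ (cvg_cst _) up); apply: filterE => n.
  have [Em /ltW ->] := hm n; rewrite andbT; apply: ge_inf => //; by exists 0.
have [r fr] : exists r, feasible (inf E) r.
  by apply: (feasible_closed m_) => // n; have [[]] := hm n.
have [i0|i0] := ltP 0 (inf E); last first.
  by exists r; have -> : 0 = inf E by apply/eqP; rewrite eq_le inf0 i0.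
have [m' /andP[m'0 m'lt] fm'] := feasible_decrease _ _ i0 fr.
have : inf E <= m'.
  by apply: ge_inf; [exists 0|split => //; rewrite m'0 /= (le_trans (ltW m'lt))].
by rewrite leNgt m'lt.
Qed.

End Realization.

Lemma cone_angle_realize {V : finType} {tri : {set {set V}}} {R : realType}
    {Theta : {set V} -> R} (s : V -> R) :
  is_surface_triangulation tri ->
  (forall e, e \in edges tri -> 0 <= Theta e < pi) ->
  C1 tri Theta ->
  (forall A : {set V}, A != finset.set0 -> A != [set: V]%SET ->
     \sum_(v in A) s v < \sum_(t in tri) capacity Theta A t) ->
  \sum_(v in [set: V]%SET) s v = \sum_(t in tri) capacity Theta [set: V]%SET t ->
  exists2 r : V -> R, forall v, 0 < r v & cone_angle tri Theta r =1 s.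
Proof.
move=> surf Theta_bound c1 s_lt s_total.
have {}s_total : \sum_v s v = \sum_(t in tri) capacity Theta [set: V]%SET t.
  by rewrite -s_total; apply: eq_bigl => v; rewrite inE.
have [e e0 he] := capacity_margin surf Theta_bound c1 _ s_lt.
(* The added 1 makes [d * #|V|] strictly smaller than [e]. *)
have d0 : 0 < e / (#|V|%:R + 1) by rewrite divr_gt0 // ltr_wpDl.
have de : e / (#|V|%:R + 1) * #|V|%:R < e.
  by rewrite mulrAC ltr_pdivrMr ?ltr_wpDl // mulrDr mulr1 ltrDl.
have [r fr] := feasible0_exists surf Theta_bound c1 s s_total _ d0 _ he de.
by exists r; [have [] := fr|exact: (feasible0 surf Theta_bound c1 _ s_total _ r fr)].
Qed.
Theorem theorem0p5 (V : finType) (tri : {set {set V}}) (R : realType)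
    (Theta : {set V} -> R) :
  is_surface_triangulation tri ->
  (forall e, e \in edges tri -> 0 <= Theta e < pi) ->
  C1 tri Theta ->
  (forall r r' : V -> R, (forall v, 0 < r v) -> (forall v, 0 < r' v) ->
     Th tri Theta r = Th tri Theta r' -> exists2 c : R, 0 < c & r' = (fun v => c * r v))
  /\
  (forall K : V -> R,
     (exists2 r : V -> R, (forall v, 0 < r v) & Th tri Theta r = K) <->
     ((forall v, if bd_vertex tri v then K v < pi else K v < 2 * pi) /\
      (forall A : {set V}, A != finset.set0 ->
         let rhs := - link_sum tri Theta A + 2 * pi * (chi_int tri A)%:~R
                    + pi * (chi_bd tri A)%:~R in
         rhs <= \sum_(v in A) K v /\ (\sum_(v in A) K v = rhs <-> A = [set: V])))).
Proof.
move=> surf Theta_bound c1.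
split=> [r r' r0 r'0 E|K].
  apply: (cone_angle_inj surf Theta_bound c1) => // v.
  by have := congr1 (fun f => f v) E; rewrite /Th => /addrI /oppr_inj.
pose base v : R := if bd_vertex tri v then pi else 2 * pi.
have capE := @capacity_sum _ _ _ Theta surf.
split=> [[r r0 <-]|[_ hA]].
  split=> [v|A A0 rhs].
    have := cone_angle_gt0 surf Theta_bound c1 r v r0.
    by rewrite /Th; case: (bd_vertex tri v) => h; lra.
  (* Subtracting from the sum of [base] over [A] turns the required inequality into the bound of the
     cone angles over [A] by the capacity of [A]. *)
  have {capE} capE : \sum_(v in A) base v - rhs = \sum_(t in tri) capacity Theta A t := capE A.
  have -> : \sum_(v in A) Th tri Theta r v =
      \sum_(v in A) base v - \sum_(v in A) cone_angle tri Theta r v by rewrite -sumrB.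
  clearbody rhs; have [AT|AT] := eqVneq A [set: V].
    have := sum_cone_angleT surf Theta_bound c1 r r0.
    rewrite -AT -capE => ->; rewrite subKr; split => //; split => // _; exact: subKr.
  have := sum_cone_angle_lt surf Theta_bound c1 r A r0 A0 AT.
  rewrite -capE => h; split; first by lra.
  by split=> [e|e]; [exfalso; lra|rewrite e eqxx in AT].
(* The cone angles to realize are [base v - K v]. The equality clause makes the inequality strict
   for proper [A] and supplies the total for [A = V]. *)
have [A A0 AT||r r0 h] := cone_angle_realize (fun v => base v - K v) surf Theta_bound c1.
- have [le eq] := hA A A0; rewrite sumrB -capE.
  suff : \sum_(v in A) K v != - link_sum tri Theta A + 2 * pi * (chi_int tri A)%:~R
                    + pi * (chi_bd tri A)%:~R by rewrite /base lt_neqAle; lra.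
  by apply: contraNneq AT => /eq ->.
- have [v _] : exists v : V, True.
    have [[/finset.set0Pn[t tt] card3 _ _] _] := surf.
    by have /card_gt0P[v _] : (0 < #|t|)%N by [rewrite card3]; exists v.
  have [|_ eq] := hA [set: V]; first by apply/finset.set0Pn; exists v; rewrite inE.
  by rewrite sumrB -capE; have := eq.2 erefl => ->.
by exists r => //; apply: funext => v; rewrite /Th h subKr.
Qed.
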